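(* Let $d,m,s\in\mathbb{N}$, $\alpha\in(0,1]$, $p\in\{1,2,3\}$, let $\mathcal{A}=(a_{ij})\in\mathbb{R}^{s\times s}$, $b=(b_i)\in\mathbb{R}^s$ and put $c_i:=\sum_{j=1}^sa_{ij}$. The simplified Runge–Kutta method with coefficients $(\mathcal{A},b)$, approximating the equation $dy^h(t)=f(y^h(t))\,dX^h(t)$, $y^h(t_0)=y_0$, driven by the piecewise linear path $X^h$, has a local error of order $(p+1)\alpha$, i.e. $$|le^h(t_0,y_0;h)|=\mathcal{O}(h^{(p+1)\alpha})\quad\text{for sufficiently small }h>0,$$ if and only if the following conditions hold for all $\ell=1,\ldots,p$: - $\ell=1$: $\ \sum_{i=1}^sb_i=1$; - $\ell=2$: $\ \sum_{i=1}^sb_ic_i=\frac12$; - $\ell=3$: $\ \sum_{i=1}^sb_ic_i^2=\frac13\ $ and $\ \sum_{i=1}^s\sum_{j=1}^sb_ia_{ij}c_j=\frac16$.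
   Context: **Drivers.** $X=(X^1,\ldots,X^d):[0,T]\to\mathbb{R}^d$ is an $\alpha$-Hölder path underlying an $\alpha$-Hölder geometric rough path $\mathbf{X}$ that is the limit, in the $\alpha$-Hölder rough path metric, of the natural lifts (by iterated integrals) of the piecewise linear interpolations of $X$ as the mesh tends to $0$. $X_{s,t}=X(t)-X(s)$. **Piecewise linear driver.** On a grid interval $[t_k,t_{k+1}]$, $X^h(t)=X(t_k)+\frac{t-t_k}{t_{k+1}-t_k}X_{t_k,t_{k+1}}$. Here only the first step, from $t_0$ to $t_1=t_0+h$, matters; $y^h$ solves the (ordinary) equation $dy^h(t)=f(y^h(t))\,dX^h(t)=\sum_{k=1}^df_k(y^h(t))\,dX^{h,k}(t)$, $y^h(t_0)=y_0$. **Simplified Runge–Kutta method.** With $f(y)x=\sum_{k=1}^df_k(y)x^k$, one step is $$Y_i^h=y_n^h+\sum_{j=1}^sa_{ij}f(Y_j^h)X_{t_n,t_{n+1}}\ (i=1,\ldots,s),\qquad y_{n+1}^h=y_n^h+\sum_{i=1}^sb_if(Y_i^h)X_{t_n,t_{n+1}},\qquad y_0^h=y_0.$$ The first system may be implicit; solutions are assumed to exist. **Local error.** $le^h(t_0,y_0;h):=y^h(t_0+h)-y_1^h$. **Meaning of ''has a local error of order $(p+1)\alpha$''.** This is a property of the method: for every $\alpha$-Hölder path $X=(X^1,\ldots,X^d):[0,T]\to\mathbb{R}^d$ underlying an $\alpha$-Hölder geometric rough path $\mathbf{X}$ that is the limit, in the $\alpha$-Hölder rough path metric, of the natural lifts (by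 iterated integrals) of the piecewise linear interpolations of $X$ as the mesh tends to $0$, every $t_0\in[0,T)$, every $y_0\in\mathbb{R}^m$ and every collection $f=(f_1,\ldots,f_d)$ of vector fields on $\mathbb{R}^m$ which is sufficiently smooth and bounded with bounded derivatives, concretely each $f_k$ is bounded, $p$-times continuously differentiable with all derivatives up to order $p$ bounded and the $p$-th derivative globally Lipschitz, one has $|le^h(t_0,y_0;h)|=\mathcal{O}(h^{(p+1)\alpha})$ as $h\to0$. *)

(* Defs.v *)
From HB Require Import structures.
From mathcomp Require Import all_boot all_order all_algebra.
From mathcomp Require Import all_classical all_reals all_analysis.

Set Implicit Arguments.
Unset Strict Implicit.
Unset Printing Implicit Defensive.
Import Order.TTheory GRing.Theory Num.Theory.
Import numFieldNormedType.Exports.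
Local Open Scope classical_set_scope.
Local Open Scope ring_scope.

(* R^n is 'rV[R]_n with its max norm; a path on [0, T]
   is a total function on R of which only the values on [0, T] are used. *)

Section Paths.
Context {R : realType} {d : nat}.
Implicit Types (X x : R -> 'rV[R]_d) (D : seq R).

Definition holder_path (alpha T : R) X : Prop :=
  exists C : R, forall s t, 0 <= s -> s <= t -> t <= T ->
    `|X t - X s| <= C * (t - s) `^ alpha.

Definition lipschitz_path (T : R) X : Prop := [lipschitz X t | t in `[0, T]].

Definition linear_piece X (a b t : R) : 'rV[R]_d :=
  X a + ((t - a) / (b - a)) *: (X b - X a).

(* Interpolation at the points a :: D, where a :: D is increasing. *)
Fixpoint pl_interp X (a : R) D (t : R) : 'rV[R]_d :=
  if D is b :: D' then
    if t <= b then linear_piece X a b t else pl_interp X b D' t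
  else X a.

Definition mesh (a : R) D : R :=
  \big[Num.max/0]_(i < size D) (nth 0 (a :: D) i.+1 - nth 0 (a :: D) i).

End Paths.

Section RoughPaths.
Context {R : realType} {d : nat}.

(* A two-parameter functional (s, t) |-> X_{s,t} in the truncated tensor
   algebra, given by its coordinates: X s t w is the coefficient of
   e_{w_1} (x) ... (x) e_{w_k}, w = [:: w_1; ...; w_k]. Only words of length at
   most [rp_level alpha] are meaningful. *)
Definition tensor_functional := R -> R -> seq 'I_d -> R.

Definition rp_level (alpha : R) : nat := Num.truncn alpha^-1.

(* For r = [:: i_k; ...; i_1], the iterated integral
   \int_{s < u_1 < ... < u_k < t} dx^{i_1}(u_1) ... dx^{i_k}(u_k)
   of an absolutely continuous path x, with dx(u) = x'(u) du. The total
   derivative takes a default value at the (negligibly many) points where x is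
   not differentiable. *)
Fixpoint iterated_integral_rev (x : R -> 'rV[R]_d) (s : R) (r : seq 'I_d)
    (t : R) : R :=
  if r is i :: r' then
    Rintegral (@lebesgue_measure R) `[s, t]
      (fun u => iterated_integral_rev x s r' u * derive1 (fun v => x v 0 i) u)
  else 1.

Definition natural_lift (x : R -> 'rV[R]_d) : tensor_functional :=
  fun s t w => iterated_integral_rev x s (rev w) t.

Definition rp_dist (alpha T : R) (X Y : tensor_functional) : \bar R :=
  ereal_sup [set z : \bar R | exists s t w,
    [/\ 0 <= s, s < t, t <= T, (1 <= size w <= rp_level alpha)%N &
        z = (`|X s t w - Y s t w| / (t - s) `^ ((size w)%:R * alpha))%:E]].

Definition multiplicative_functional (alpha T : R) (X : tensor_functional) :
    Prop :=
  (forall s t, 0 <= s -> s <= t -> t <= T -> X s t [::] = 1) /\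
  (forall s u t w, 0 <= s -> s <= u -> u <= t -> t <= T ->
     (size w <= rp_level alpha)%N ->
     X s t w = \sum_(k < (size w).+1) X s u (take k w) * X u t (drop k w)).

Definition rough_path (alpha T : R) (X : tensor_functional) : Prop :=
  multiplicative_functional alpha T X /\
  exists C : R, forall s t w, 0 <= s -> s <= t -> t <= T ->
    (1 <= size w <= rp_level alpha)%N ->
    `|X s t w| <= C * (t - s) `^ ((size w)%:R * alpha).

(* The closure of the lifts of Lipschitz paths. For alpha < 1 this is also the
   closure of the lifts of smooth paths. *)
Definition geometric_rough_path (alpha T : R) (X : tensor_functional) : Prop :=
  rough_path alpha T X /\
  forall eps : R, 0 < eps -> exists x : R -> 'rV[R]_d,
    lipschitz_path T x /\ (rp_dist alpha T (natural_lift x) X < eps%:E)%E.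

Definition underlies (T : R) (x : R -> 'rV[R]_d) (X : tensor_functional) :
    Prop :=
  forall s t i, 0 <= s -> s <= t -> t <= T -> X s t [:: i] = (x t - x s) 0 i.

Definition limit_of_pl_lifts (alpha T : R) (x : R -> 'rV[R]_d)
    (X : tensor_functional) : Prop :=
  forall eps : R, 0 < eps -> exists2 delta : R, 0 < delta &
    forall D : seq R, itv_partition 0 T D -> mesh 0 D < delta ->
      (rp_dist alpha T (natural_lift (pl_interp x 0 D)) X < eps%:E)%E.

Definition driver (alpha T : R) (x : R -> 'rV[R]_d) : Prop :=
  holder_path alpha T x /\
  exists X : tensor_functional,
    [/\ geometric_rough_path alpha T X, underlies T x X &
        limit_of_pl_lifts alpha T x X].

End RoughPaths.

Section VectorFields.
Context {R : realType} {m : nat}.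
Implicit Type g : 'rV[R]_m -> 'rV[R]_m.

(* iter_derive g [:: v_1; ...; v_k] x = D^k g(x)[v_k, ..., v_1]; the operator
   norm of D^k g(x) is the supremum of its norm over |v_i| <= 1. *)
Definition iter_derive g (vs : seq 'rV[R]_m) : 'rV[R]_m -> 'rV[R]_m :=
  foldr (fun v u => fun x => 'D_v u x) g vs.

Definition Cp g (p : nat) : Prop :=
  (forall vs, (size vs < p)%N ->
     forall x, differentiable (iter_derive g vs) x) /\
  (forall vs, (size vs <= p)%N -> continuous (iter_derive g vs)).

Definition bounded_derivatives g (p : nat) : Prop :=
  exists M : R, forall vs, (size vs <= p)%N ->
    (forall v, v \in vs -> `|v| <= 1) ->
    forall x, `|iter_derive g vs x| <= M.

Definition lipschitz_derivative g (p : nat) : Prop :=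
  exists L : R, forall vs, size vs = p ->
    (forall v, v \in vs -> `|v| <= 1) ->
    forall x y, `|iter_derive g vs x - iter_derive g vs y| <= L * `|x - y|.

Definition smooth_bounded g (p : nat) : Prop :=
  [/\ Cp g p, bounded_derivatives g p & lipschitz_derivative g p].

End VectorFields.

Section RungeKutta.
Context {R : realType} {d m s : nat}.
Implicit Types (f : 'I_d -> 'rV[R]_m -> 'rV[R]_m) (X : R -> 'rV[R]_d).

Definition field_app f (y : 'rV[R]_m) (x : 'rV[R]_d) : 'rV[R]_m :=
  \sum_(k < d) x 0 k *: f k y.

Definition solves_pl_ode f X (t0 h : R) (y0 : 'rV[R]_m) (y : R -> 'rV[R]_m) :
    Prop :=
  [/\ y t0 = y0, {within `[t0, t0 + h], continuous y} &
      forall t, t0 < t < t0 + h ->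
        is_derive t 1 y
          (field_app f (y t) (derive1 (linear_piece X t0 (t0 + h)) t))].

Definition rk_stages (A : 'M[R]_s) f (y0 : 'rV[R]_m) (x : 'rV[R]_d)
    (Y : 'I_s -> 'rV[R]_m) : Prop :=
  forall i, Y i = y0 + \sum_(j < s) A i j *: field_app f (Y j) x.

Definition rk_step (b : 'rV[R]_s) f (y0 : 'rV[R]_m) (x : 'rV[R]_d)
    (Y : 'I_s -> 'rV[R]_m) : 'rV[R]_m :=
  y0 + \sum_(i < s) b 0 i *: field_app f (Y i) x.

Definition local_error (b : 'rV[R]_s) f X (t0 h : R) (y0 : 'rV[R]_m)
    (y : R -> 'rV[R]_m) (Y : 'I_s -> 'rV[R]_m) : 'rV[R]_m :=
  y (t0 + h) - rk_step b f y0 (X (t0 + h) - X t0) Y.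

End RungeKutta.

(* yh h and Yh h are the solution y^h and the stages (Y_i^h)_i for step size h;
   they are assumed to exist for small h (where they are in fact unique, the
   f k being Lipschitz). *)
Definition has_local_error_order (R : realType) (d m s : nat) (alpha T : R)
    (p : nat) (A : 'M[R]_s) (b : 'rV[R]_s) : Prop :=
  forall (X : R -> 'rV[R]_d) (t0 : R) (y0 : 'rV[R]_m)
         (f : 'I_d -> 'rV[R]_m -> 'rV[R]_m)
         (yh : R -> R -> 'rV[R]_m) (Yh : R -> 'I_s -> 'rV[R]_m),
    driver alpha T X -> 0 <= t0 < T -> (forall k, smooth_bounded (f k) p) ->
    (\forall h \near 0^'+, solves_pl_ode f X t0 h y0 (yh h)) ->
    (\forall h \near 0^'+, rk_stages A f y0 (X (t0 + h) - X t0) (Yh h)) ->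
    (fun h => local_error b f X t0 h y0 (yh h) (Yh h))
      =O_ (0^'+) (fun h => h `^ (p.+1%:R * alpha)).

Definition rk_c (R : realType) (s : nat) (A : 'M[R]_s) (i : 'I_s) : R :=
  \sum_(j < s) A i j.

Definition order_condition (R : realType) (s : nat) (A : 'M[R]_s)
    (b : 'rV[R]_s) (l : nat) : Prop :=
  match l with
  | 1 => \sum_(i < s) b 0 i = 1
  | 2 => \sum_(i < s) b 0 i * rk_c A i = 2^-1
  | 3 => \sum_(i < s) b 0 i * rk_c A i ^+ 2 = 3^-1 /\
         \sum_(i < s) \sum_(j < s) b 0 i * A i j * rk_c A j = 6^-1
  | _ => True
  end.

(* Main.v *)
From HB Require Import structures.
Require Import Defs.
From mathcomp Require Import all_boot all_order all_algebra.
From mathcomp Require Import all_classical all_reals all_analysis measurable_realfun.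
From mathcomp Require Import ring lra.
Set Implicit Arguments.
Unset Strict Implicit.
Unset Printing Implicit Defensive.
Import Order.TTheory GRing.Theory Num.Theory.
Import numFieldNormedType.Exports.
Local Open Scope classical_set_scope.
Local Open Scope ring_scope.

(** Write x for the increment X(t0 + h) - X(t0). On one grid interval the
driver is affine, so the exact equation is, up to a rescaling of time to
[0, 1], the autonomous equation y' = f(y)x, and the scheme is one unit step of
the ordinary Runge-Kutta method for it. Let F = f(y0)x, and let D and H be the
first and second derivatives of f(.)x at y0. All of them are O(|x|), and
grouping terms by powers of x gives, up to O(|x|^(p+1)), the parts of degree at
most p of

  exact increment    F + 1/2 DF + 1/6 (DDF + H(F,F)),

  numerical increment
    (sum b_i) F + (sum b_i c_i) DF + (sum b_i a_ij c_j) DDF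
      + 1/2 (sum b_i c_i^2) H(F,F).

Both expansions come out of the same bootstrap ([picard_expansion]): the
displacement from y0 is an average of f(.)x along the trajectory or over the
stages, so each expansion of f(.)x at the displaced points yields one more
order for the displacement, which yields one more order for f(.)x. The
difference of the two increments ([local_error_expansion]) is then a
combination of F, DF, DDF and H(F,F) whose coefficients are, up to a factor,
the residuals of the order conditions. As |x| = O(h^alpha), the conditions are sufficient.

For necessity a driver and vector fields are needed for which no residual can
hide. A driver with increments of exact size h^alpha is impossible for
alpha < 1: limits of Lipschitz paths in the alpha-Hoelder metric have
increments o(h^alpha). The path X(t) = t^beta e, with beta slightly larger than
alpha, is one ([driver_powR]): it stays on a line, hence its iterated integrals
and those of its interpolations are powers of increments divided by factorials,
and convergence of the lifts reduces to convergence of the interpolations of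
t^beta in the alpha-Hoelder norm. With 3 beta < 4 alpha, a residual of degree
l <= 3 in x contributes h^(l beta), which is not O(h^((l+1) alpha)). The vector
field cos^2 is used because its equation is solved explicitly by arctangents of
affine functions; started at arctan 0 the second derivative contributes and the
first does not, and conversely at arctan 1, so the two conditions of degree 3
are tested separately ([order_conditions_necessary]). *)

(** * Mean value inequalities for curves *)

Section Vectors.
Context {R : realType} {n : nat}.
Implicit Types (v : 'rV[R]_n) (a b t K : R) (g : R -> 'rV[R]_n).

Lemma rV_norm_le v K : 0 <= K -> (forall i, `|v 0 i| <= K) -> `|v| <= K.
Proof.
move=> K0 vK; rewrite [leLHS]/Num.Def.normr/= mx_normrE.
by apply: bigmax_le => // -[i j] _ /=; rewrite (ord1 i).
Qed.

Lemma rV_coord_le v i : `|v 0 i| <= `|v|.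
Proof.
rewrite [leRHS]/Num.Def.normr/= mx_normrE.
exact: (le_bigmax _ (fun ij : 'I_1 * 'I_n => `|v ij.1 ij.2|) (0, i)).
Qed.

Lemma is_derive_coord g t d i :
  is_derive t 1 g d -> is_derive t 1 (fun u => g u 0 i) (d 0 i).
Proof.
move=> dg; have dgt : derivable g t 1 by [].
split; first by move/derivable_mxP : dgt.
by rewrite -(@derive_val _ _ _ _ _ _ _ dg) (derive_mx dgt) mxE.
Qed.

Lemma within_continuous_coord (D : set R) g i :
  {within D, continuous g} -> {within D, continuous (fun t => g t 0 i)}.
Proof.
move=> cg t; apply: (@continuous_comp (subspace D) _ _ g
  (fun v : 'rV[R]_n => v 0 i)); [exact: cg|exact: coord_continuous].
Qed.

(** With the maximum norm the vector inequality is the scalar mean value theorem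
in each coordinate; continuity at the end points suffices, as the solutions of
the driven equation are only differentiable inside the step. *)
Lemma mean_value_le g (dg : R -> 'rV[R]_n) a b K :
  (forall t, a < t < b -> is_derive t 1 g (dg t)) ->
  {within `[a, b], continuous g} ->
  (forall t, a < t < b -> `|dg t| <= K) ->
  forall t, a <= t <= b -> `|g t - g a| <= K * (t - a).
Proof.
move=> dgP cg dgK t /andP[]; rewrite le_eqVlt => /predU1P[<- _|lt_at tb].
  by rewrite !subrr normr0 mulr0.
have K0 : 0 <= K.
  by apply: le_trans (dgK ((a + t) / 2) _); [exact: normr_ge0|lra].
apply: rV_norm_le => [|i]; first by rewrite mulr_ge0// subr_ge0 ltW.
have dgi u : u \in `]a, t[ -> is_derive u 1 (fun u => g u 0 i) (dg u 0 i).
  rewrite in_itv/= => /andP[au ut]; apply: is_derive_coord.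
  by apply: dgP; rewrite au (lt_le_trans ut).
have cgi : {within `[a, t], continuous (fun u => g u 0 i)}.
  apply: within_continuous_coord; apply: continuous_subspaceW cg.
  by apply: subset_itvl; rewrite bnd_simp.
have [c] := MVT lt_at dgi cgi.
rewrite in_itv/= => /andP[ac ct]; rewrite !mxE => ->.
rewrite normrM (@ger0_norm _ (t - a)) ?subr_ge0 ?(ltW lt_at)//.
apply: ler_wpM2r; first by rewrite subr_ge0 ltW.
apply: le_trans (rV_coord_le _ _) _.
by apply: dgK; rewrite ac (lt_le_trans ct).
Qed.

Lemma norm_lincomb s (a : 'I_s -> R) (w : 'I_s -> 'rV[R]_n) K :
  (forall i, `|w i| <= K) ->
  `|\sum_(i < s) a i *: w i| <= (\sum_(i < s) `|a i|) * K.
Proof.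
move=> wK; rewrite mulr_suml; apply: le_trans (ler_norm_sum _ _ _) _.
by apply: ler_sum => i _; rewrite normrZ ler_wpM2l.
Qed.

End Vectors.

Lemma is_derive_pow_fact {R : realType} (q : R -> R) (dq t : R) (k : nat) :
  is_derive t 1 q dq ->
  is_derive t 1 (fun u => q u ^+ k.+1 / (k.+1)`!%:R) (q t ^+ k / k`!%:R * dq).
Proof.
move=> dqt.
rewrite (_ : (fun _ => _) = ((k.+1)`!%:R)^-1 \*: (q ^+ k.+1)); last first.
  by apply/funext => u; rewrite mulrC /= exprfctE.
apply: is_derive_eq; rewrite /GRing.scale/= factS natrM invfM.
have k0 : k.+1%:R != 0 :> R by rewrite pnatr_eq0.
transitivity ((k.+1%:R^-1 * k.+1%:R) * (q t ^+ k / k`!%:R * dq)).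
  by ring.
by rewrite mulVf// mul1r.
Qed.

Section Curves.
Context {R : realType} {n : nat}.
Implicit Types (g : R -> 'rV[R]_n).

Lemma derive_continuous g (dg : R -> 'rV[R]_n) :
  (forall t : R, is_derive t 1 g (dg t)) -> continuous g.
Proof.
by move=> dgP t; apply/differentiable_continuous/derivable1_diffP; have := dgP t.
Qed.

Lemma curve_taylor1 g0 (g1 : R -> 'rV[R]_n) K :
  (forall t : R, is_derive t 1 g0 (g1 t)) ->
  (forall t, 0 <= t <= 1 -> `|g1 t| <= K) ->
  forall t, 0 <= t <= 1 -> `|g0 t - g0 0| <= K.
Proof.
move=> d0 g1K t t01.
have K0 : 0 <= K by apply: le_trans (g1K 0 _); rewrite ?lexx ?ler01.
apply: le_trans (mean_value_le (fun t _ => d0 t) _ _ t01) _.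
- by apply: continuous_subspaceT; exact: derive_continuous d0.
- by move=> u /andP[u0 u1]; apply: g1K; rewrite !ltW.
- by rewrite subr0 ler_piMr//; case/andP: t01.
Qed.

Lemma is_derive_scalel (phi : R -> R) (dphi t : R) (v : 'rV[R]_n) :
  is_derive t 1 phi dphi -> is_derive t 1 (fun u => phi u *: v) (dphi *: v).
Proof.
move=> dp; have dv : differentiable (fun u => phi u *: v) t.
  by apply: differentiableZl; apply/derivable1_diffP.
split; first exact/derivable1_diffP.
apply/rowP => i; rewrite (derive_mx (proj2 (derivable1_diffP _ _) dv)) !mxE.
rewrite (_ : (fun _ => _) = v 0 i \*: phi); last first.
  by apply/funext => u; rewrite mxE mulrC.
by rewrite derive_val mulrC.
Qed.

Lemma is_derive_half_sqr (t : R) : is_derive t 1 (fun u : R => u ^+ 2 / 2) t.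
Proof.
rewrite (_ : (fun _ => _) = 2^-1 \*: ((id : R -> R) ^+ 2)).
  by apply: is_derive_eq; rewrite expr1 /GRing.scale/=; by field.
by apply/funext => u; rewrite [RHS]mulrC.
Qed.

(** The Taylor remainder at each order is a curve vanishing at 0 whose derivative
is the remainder of the previous order. The factors t and t^2 of the sharp
estimates are dropped, since only t = 1 is used. *)
Lemma curve_taylor2 g0 (g1 g2 : R -> 'rV[R]_n) K :
  (forall t : R, is_derive t 1 g0 (g1 t)) ->
  (forall t : R, is_derive t 1 g1 (g2 t)) ->
  (forall t, 0 <= t <= 1 -> `|g2 t| <= K) ->
  forall t, 0 <= t <= 1 -> `|g0 t - g0 0 - t *: g1 0| <= K.
Proof.
move=> d0 d1 g2K t t01; have := curve_taylor1 d1 g2K.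
pose h u := g0 u - u *: g1 0 => g1K.
have dh (u : R) : is_derive u 1 h (g1 u - g1 0).
  have := is_deriveB (d0 u) (is_derive_scalel (g1 0) (is_derive_id u 1)).
  by rewrite scale1r.
have := curve_taylor1 dh g1K t01.
by rewrite /h scale0r subr0 addrAC.
Qed.

Lemma curve_taylor3 g0 (g1 g2 g3 : R -> 'rV[R]_n) K :
  (forall t : R, is_derive t 1 g0 (g1 t)) ->
  (forall t : R, is_derive t 1 g1 (g2 t)) ->
  (forall t : R, is_derive t 1 g2 (g3 t)) ->
  (forall t, 0 <= t <= 1 -> `|g3 t| <= K) ->
  forall t, 0 <= t <= 1 -> `|g0 t - g0 0 - t *: g1 0 - (t ^+ 2 / 2) *: g2 0| <= K.
Proof.
move=> d0 d1 d2 g3K t t01; have := curve_taylor2 d1 d2 g3K.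
pose h u := g0 u - u *: g1 0 - (u ^+ 2 / 2) *: g2 0 => g1K.
have dh (u : R) : is_derive u 1 h (g1 u - g1 0 - u *: g2 0).
  apply: is_deriveB (is_derive_scalel _ (is_derive_half_sqr u)).
  have := is_deriveB (d0 u) (is_derive_scalel (g1 0) (is_derive_id u 1)).
  by rewrite scale1r.
have := curve_taylor1 dh g1K t01.
by rewrite /h scale0r expr0n mul0r scale0r !subr0 -!addrA [- g0 0 + _]addrC -!addrA.
Qed.

End Curves.

(** * Directional Taylor formulas for vector fields *)

Section IteratedDerivatives.
Context {R : realType} {m : nat}.
Local Notation V := 'rV[R]_m.
Implicit Types (g : V -> V) (p : nat) (u v x y : V).

(** Homogeneity in every direction argument lets bounds on unit directions be
transferred to arbitrary ones. *)
Lemma iter_deriveZ g p (cs : seq (R * V)) : Cp g p -> (size cs <= p)%N ->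
  iter_derive g [seq c.1 *: c.2 | c <- cs] =
  (fun y => (\prod_(c <- cs) c.1) *: iter_derive g [seq c.2 | c <- cs] y).
Proof.
move=> [dg _]; elim: cs => [_|[c v] cs ih /= lep].
  by apply/funext => y; rewrite big_nil scale1r.
have du y : differentiable (iter_derive g [seq c.2 | c <- cs]) y.
  by apply: dg; rewrite size_map.
rewrite (ih (ltnW lep)); apply/funext => y; rewrite big_cons.
rewrite deriveZ/=; last exact: diff_derivable.
rewrite !deriveE// linearZ scalerA mulrC; congr (_ *: _).
Qed.

(** Write each direction v as |v| times a vector of norm at most 1. *)
Lemma iter_derive_le g p : smooth_bounded g p -> exists M : R,
  forall vs, (size vs <= p)%N -> forall y,
    `|iter_derive g vs y| <= M * \prod_(v <- vs) `|v|.
Proof.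
move=> [Cg [M bM] _]; exists M => vs svs y.
(* For v = 0 the second component is 0, and 0 *: 0 still recovers v. *)
pose cs := [seq (`|v|, `|v|^-1 *: v) | v <- vs].
have -> : vs = [seq c.1 *: c.2 | c <- cs].
  rewrite -map_comp -[LHS]map_id; apply: eq_map => v /=.
  have [->|v0] := eqVneq v 0; first by rewrite !scaler0.
  by rewrite scalerA divff ?scale1r// normr_eq0.
rewrite (iter_deriveZ Cg) ?size_map// normrZ mulrC.
have -> : \prod_(v <- [seq c.1 *: c.2 | c <- cs]) `|v| =
          \prod_(c <- cs) c.1.
  rewrite !big_map; apply: eq_bigr => v _ /=.
  have [->|v0] := eqVneq v 0; first by rewrite !scaler0 normr0.
  by rewrite scalerA divff ?scale1r// normr_eq0.
have P0 : 0 <= \prod_(c <- cs) c.1.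
  by rewrite big_map; apply: prodr_ge0 => v _ /=; exact: normr_ge0.
rewrite (ger0_norm P0) ler_wpM2r// bM ?size_map// => w.
rewrite -map_comp => /mapP[v _ ->] /=; rewrite normrZ normfV normr_id.
have [->|v0] := eqVneq v 0; first by rewrite normr0 mulr0 ler01.
by rewrite mulVf ?normr_eq0 ?lexx.
Qed.

(** The two difference quotients are the same function of the increment. *)
Lemma is_derive_line g y u (t : R) : differentiable g (y + t *: u) ->
  is_derive t 1 (fun r : R => g (y + r *: u)) ('D_u g (y + t *: u)).
Proof.
move=> dg; have dgu : derivable g (y + t *: u) u by exact: diff_derivable.
have E : (fun h : R => h^-1 *: (g (y + (h *: 1 + t) *: u) - g (y + t *: u))) =
         (fun h : R => h^-1 *: (g (h *: u + (y + t *: u)) - g (y + t *: u))).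
  apply/funext => h; rewrite [h *: 1]mulr1 scalerDl.
  by rewrite [in RHS]addrCA.
by split; rewrite /derivable /derive /= E.
Qed.

Lemma is_derive_iter_line g p vs u y (t : R) : Cp g p -> (size vs < p)%N ->
  is_derive t 1 (fun r : R => iter_derive g vs (y + r *: u))
    (iter_derive g (u :: vs) (y + t *: u)).
Proof. by move=> [dg _] svs; apply: is_derive_line; exact: dg. Qed.

(** Taylor expansion along the segment from y to y + u: the remainder of order q
in u comes from the bound on the q-th derivative. *)
Lemma taylor_iter_derive g p : smooth_bounded g p -> exists M : R, [/\
  (1 <= p)%N -> forall y u, `|g (y + u) - g y| <= M * `|u|,
  (2 <= p)%N -> forall y u,
    `|g (y + u) - g y - iter_derive g [:: u] y| <= M * `|u| ^+ 2,
  (3 <= p)%N -> forall y u,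
    `|g (y + u) - g y - iter_derive g [:: u] y
      - 2^-1 *: iter_derive g [:: u; u] y| <= M * `|u| ^+ 3 &
  forall vs, (size vs <= p)%N -> forall y,
    `|iter_derive g vs y| <= M * \prod_(v <- vs) `|v|].
Proof.
move=> sg; have [M bM] := iter_derive_le sg; exists M; have [Cg _ _] := sg.
have b01 : 0 <= (1 : R) <= 1 by rewrite ler01 lexx.
(* The k-th derivative of r |-> g (y + r u). *)
have d_ k := fun y u t => @is_derive_iter_line g p (nseq k u) u y t Cg.
split=> //.
- move=> p1 y u.
  have d0 t := d_ 0 y u t p1.
  have := curve_taylor1 d0 _ b01; rewrite scale1r scale0r addr0; apply=> t _.
  by have := bM [:: u] p1 (y + t *: u); rewrite big_seq1.
- move=> p2 y u.
  have d0 t := d_ 0 y u t (ltnW p2).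
  have d1 t := d_ 1 y u t p2.
  have := curve_taylor2 d0 d1 _ b01.
  rewrite !scale1r scale0r addr0; apply=> t _.
  by have := bM [:: u; u] p2 (y + t *: u); rewrite big_cons big_seq1.
- move=> p3 y u.
  have d0 t := d_ 0 y u t (ltnW (ltnW p3)).
  have d1 t := d_ 1 y u t (ltnW p3).
  have d2 t := d_ 2 y u t p3.
  have := curve_taylor3 d0 d1 d2 _ b01.
  rewrite !scale1r expr1n div1r scale0r addr0; apply=> t _.
  by have := bM [:: u; u; u] p3 (y + t *: u); rewrite !big_cons big_nil mulr1.
Qed.

End IteratedDerivatives.

Section Jets.
Context {R : realType} {m : nat}.
Local Notation V := 'rV[R]_m.

(** Abstracts what the expansions need to know about u |-> f(y0 + u)x: D and H
stand for the first two derivatives at u = 0, and the clauses requiring more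
than p derivatives are void. Every bound carries the same small factor B, which
is of the size of |x|. *)
Record jet (p : nat) (B : R) (G : V -> V) (D : V -> V) (H : V -> V -> V) :
    Prop := Jet {
  jet_le : forall u, `|G u| <= B;
  jet_taylor1 : (1 <= p)%N -> forall u, `|G u - G 0| <= B * `|u|;
  jet_taylor2 : (2 <= p)%N -> forall u, `|G u - G 0 - D u| <= B * `|u| ^+ 2;
  jet_taylor3 : (3 <= p)%N -> forall u,
    `|G u - G 0 - D u - 2^-1 *: H u u| <= B * `|u| ^+ 3;
  jet_D_le : (2 <= p)%N -> forall u, `|D u| <= B * `|u|;
  jet_D_linear : (2 <= p)%N -> linear D;
  jet_H_le : (3 <= p)%N -> forall u v, `|H u v| <= B * (`|u| * `|v|);
  jet_H_linearl : (3 <= p)%N -> forall v, linear (H^~ v);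
  jet_H_linearr : (3 <= p)%N -> forall u, linear (H u) }.

Context {d : nat}.
Implicit Types (f : 'I_d -> V -> V) (y u v : V) (x : 'rV[R]_d).

Definition field_derive f y x (vs : seq V) : V :=
  \sum_(k < d) x 0 k *: iter_derive (f k) vs y.

Lemma field_sum_le x (w : 'I_d -> V) (M : 'I_d -> R) (r : R) : 0 <= r ->
  (forall k, `|w k| <= M k * r) ->
  `|\sum_(k < d) x 0 k *: w k| <= (\sum_(k < d) `|M k|) * `|x| * r.
Proof.
move=> r0 wM; apply: le_trans (ler_norm_sum _ _ _) _.
rewrite -mulrA mulr_suml; apply: ler_sum => k _.
rewrite normrZ mulrCA; apply: ler_pM => //; first exact: rV_coord_le.
by apply: le_trans (wM k) _; rewrite ler_wpM2r// ler_norm.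
Qed.

(** The field u |-> f(y + u)x is linear in x, hence the bounds are proportional
to |x| and uniform in the base point y. *)
Lemma field_jet f p : (forall k, smooth_bounded (f k) p) ->
  exists2 M : R, 0 <= M & forall x y,
    jet p (M * `|x|) (fun u => field_app f (y + u) x)
      (fun u => field_derive f y x [:: u])
      (fun u v => field_derive f y x [:: u; v]).
Proof.
move=> sf; have [M MP] := choice (fun k => taylor_iter_derive (sf k)).
exists (\sum_k `|M k|); first exact: sumr_ge0.
move=> x y; split=> [u|p1 u|p2 u|p3 u|p2 u|p2 a u v|p3 u v|p3 w a u v|p3 w a u v].
- rewrite -[leRHS]mulr1; apply: field_sum_le => // k.
  by have [_ _ _ /(_ [::] isT)] := MP k; rewrite big_nil; exact.
- rewrite addr0 -sumrB; under eq_bigr do rewrite -scalerBr.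
  apply: field_sum_le => // k.
  by have [/(_ p1)] := MP k; exact.
- rewrite addr0 -!sumrB; under eq_bigr do rewrite -!scalerBr.
  apply: field_sum_le => [|k]; first exact: exprn_ge0.
  by have [_ /(_ p2)] := MP k; exact.
- rewrite addr0 scaler_sumr -!sumrB.
  under eq_bigr do rewrite scalerA [2^-1 * _]mulrC -scalerA -!scalerBr.
  apply: field_sum_le => [|k]; first exact: exprn_ge0.
  by have [_ _ /(_ p3)] := MP k; exact.
- apply: field_sum_le => // k.
  by have [_ _ _ /(_ [:: u] (ltnW p2))] := MP k; rewrite big_seq1; exact.
- rewrite scaler_sumr -big_split; apply: eq_bigr => k _ /=.
  have [[dk _] _ _] := sf k; have := dk [::] (ltnW p2) y => dky.
  by rewrite !deriveE// linearP scalerDr !scalerA [a * _]mulrC.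
- apply: field_sum_le => [|k]; first exact: mulr_ge0.
  have [_ _ _ /(_ [:: u; v] (ltnW p3))] := MP k.
  by rewrite big_cons big_seq1; exact.
- rewrite scaler_sumr -big_split; apply: eq_bigr => k _ /=.
  have [[dk _] _ _] := sf k; have := dk [:: w] (ltnW p3) y => dky.
  by rewrite !(deriveE _ dky)// linearP scalerDr !scalerA [a * _]mulrC.
- rewrite scaler_sumr -big_split; apply: eq_bigr => k _ /=.
  have [[dk _] _ _] := sf k; have d0 := dk [::] (ltnW (ltnW p3)).
  (* The inner derivative is linear in its direction at every point, so the
     outer one distributes over it. *)
  rewrite (_ : (fun z : V => 'D_(a *: u + v) (f k) z) =
    (a \*: (fun z : V => 'D_u (f k) z)) + (fun z : V => 'D_v (f k) z)); last first.
    apply/funext => z; rewrite (deriveE _ (d0 z)) linearP -!(deriveE _ (d0 z)).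
    by [].
  have du := dk [:: u] (ltnW p3) y; have dv := dk [:: v] (ltnW p3) y.
  rewrite deriveD; [|by apply: derivableZ; exact: diff_derivable
                    |exact: diff_derivable].
  rewrite deriveZ; last exact: diff_derivable.
  by rewrite scalerDr !scalerA [a * _]mulrC.
Qed.

End Jets.

(** * Expansion of a field at a displaced point *)

Section Expansion.
Context {R : realType} {m : nat}.
Local Notation V := 'rV[R]_m.
Implicit Types (G D : V -> V) (H : V -> V -> V).

Lemma jet_widen p B B' G D H : B <= B' -> jet p B G D H -> jet p B' G D H.
Proof.
move=> BB' [le0 t1 t2 t3 Dle Dlin Hle Hl Hr].
have widen r (v : V) : 0 <= r -> `|v| <= B * r -> `|v| <= B' * r.
  by move=> r0 /le_trans; apply; rewrite ler_wpM2r.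
split=> // [u|p1 u|p2 u|p3 u|p2 u|p3 u v].
- exact: le_trans (le0 u) BB'.
- exact: widen (t1 p1 u).
- by apply: widen (t2 p2 u); exact: exprn_ge0.
- by apply: widen (t3 p3 u); exact: exprn_ge0.
- exact: widen (Dle p2 u).
- by apply: widen (Hle p3 u v); exact: mulr_ge0.
Qed.

Lemma linear_subZ (L : V -> V) (c : R) u v :
  linear L -> L (u - c *: v) = L u - c *: L v.
Proof. by move=> linL; rewrite addrC -scaleNr linL scaleNr addrC. Qed.

(** The part of degree at most p of G(u) when u = c G(0) + e D(G(0)) + ...; here
c and e collect the coefficients of a trajectory at a given time, or of a
Runge-Kutta stage. *)
Definition stage_series (p : nat) (c e : R) G D H : V :=
  G 0 + (if (2 <= p)%N then c *: D (G 0) else 0) +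
  (if (3 <= p)%N then e *: D (D (G 0)) + (c ^+ 2 / 2) *: H (G 0) (G 0) else 0).

Lemma series_remainder1 p (M C eps c e : R) G D H u : (1 <= p)%N ->
  jet p (M * eps) G D H -> 0 <= M -> 0 <= eps -> `|u| <= C * eps ->
  `|G u - stage_series 1 c e G D H| <= (M * C) * eps ^+ 2.
Proof.
move=> p1 jG M0 e0 uC; rewrite /stage_series /= !addr0.
apply: le_trans (jet_taylor1 jG p1 u) _.
rewrite (_ : M * C * _ = (M * eps) * (C * eps)); last by ring.
by rewrite ler_wpM2l// mulr_ge0.
Qed.

Lemma series_remainder2 p (M S eps C c e : R) G D H u : (2 <= p)%N ->
  jet p (M * eps) G D H -> 0 <= M -> 0 <= C -> 0 <= eps <= 1 -> `|c| <= S ->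
  `|u - c *: G 0| <= C * eps ^+ 2 ->
  `|G u - stage_series 2 c e G D H| <= M * ((S * M + C) ^+ 2 + C) * eps ^+ 3.
Proof.
move=> p2 jG M0 C0 /andP[e0 e1] cS uC; rewrite /stage_series /= !addr0.
have e21 : eps ^+ 2 <= eps by rewrite expr2 ler_piMr.
have S0 : 0 <= S by apply: le_trans cS.
have Me0 : 0 <= M * eps by exact: mulr_ge0.
have uC1 : `|u| <= (S * M + C) * eps.
  rewrite -[u](subrK (c *: G 0)) addrC; apply: le_trans (ler_normD _ _) _.
  rewrite mulrDl -mulrA lerD//; last by apply: le_trans uC _; rewrite ler_wpM2l.
  by rewrite normrZ ler_pM//; exact: jet_le jG _.
have -> : G u - (G 0 + c *: D (G 0)) = (G u - G 0 - D u) + D (u - c *: G 0).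
  by rewrite (linear_subZ _ _ _ (jet_D_linear jG p2)) opprD !addrA subrK.
apply: le_trans (ler_normD _ _) _.
apply: (@le_trans _ _ ((M * eps) * ((S * M + C) * eps) ^+ 2
  + (M * eps) * (C * eps ^+ 2)));
  last by rewrite le_eqVlt; apply/orP; left; apply/eqP; ring.
apply: lerD; last by apply: le_trans (jet_D_le jG p2 _) _; rewrite ler_wpM2l.
apply: le_trans (jet_taylor2 jG p2 _) _; rewrite ler_wpM2l//.
by rewrite lerXn2r ?nnegrE//; apply: le_trans uC1.
Qed.

(** Split u into c F, its second order part e DF and a rest w of third order. In
the Taylor formula D u is expanded by linearity and H(u,u) differs from
c^2 H(F,F) by H(v,u) + c H(F,v), where v = u - c F is of second order. *)
Lemma series_remainder3 p (M S eps C C2 C1 c e : R) G D H u : (3 <= p)%N ->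
  C2 = S * M ^+ 2 + C -> C1 = S * M + C2 ->
  jet p (M * eps) G D H -> 0 <= M -> 0 <= C -> 0 <= eps <= 1 ->
  `|c| <= S -> `|e| <= S ->
  `|u - c *: G 0 - e *: D (G 0)| <= C * eps ^+ 3 ->
  `|G u - stage_series 3 c e G D H| <=
    M * (C1 ^+ 3 + C + C1 * C2 + S * M * C2) * eps ^+ 4.
Proof.
move=> p3 C2E C1E jG M0 C0 /andP[e0 e1] cS eS uC; rewrite /stage_series /=.
have p2 := ltnW p3.
have e21 : eps ^+ 2 <= eps by rewrite expr2 ler_piMr.
have e32 : eps ^+ 3 <= eps ^+ 2 by rewrite exprS ler_piMl// exprn_ge0.
have S0 : 0 <= S by apply: le_trans cS.
have Me0 : 0 <= M * eps by exact: mulr_ge0.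
set F := G 0 in uC *; set w := u - c *: F - e *: D F in uC *.
set v := u - c *: F.
have F_le : `|F| <= M * eps by exact: jet_le jG _.
have C20 : 0 <= C2 by rewrite C2E addr_ge0// mulr_ge0// exprn_ge0.
have vC2 : `|v| <= C2 * eps ^+ 2.
  rewrite -[v](subrK (e *: D F)) addrC; apply: le_trans (ler_normD _ _) _.
  rewrite C2E mulrDl lerD//; last by apply: le_trans uC _; rewrite ler_wpM2l.
  rewrite normrZ -mulrA ler_pM// -exprMn expr2.
  by apply: le_trans (jet_D_le jG p2 _) _; rewrite ler_wpM2l.
have uC1 : `|u| <= C1 * eps.
  rewrite -[u](subrK (c *: F)) addrC; apply: le_trans (ler_normD _ _) _.
  rewrite C1E mulrDl -mulrA lerD//; last by apply: le_trans vC2 _; rewrite ler_wpM2l.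
  by rewrite normrZ ler_pM.
have cF_le : `|c *: F| <= S * (M * eps) by rewrite normrZ ler_pM.
have Dlin := jet_D_linear jG p2.
have Hl z := jet_H_linearl jG p3 z; have Hr z := jet_H_linearr jG p3 z.
have Dw : D w = D u - c *: D F - e *: D (D F).
  by rewrite /w (linear_subZ _ _ _ Dlin) (linear_subZ _ _ _ Dlin).
have Hv : H v u = H u u - c *: H F u by rewrite (linear_subZ _ _ _ (Hl u)).
have HFv : H F v = H F u - c *: H F F by rewrite (linear_subZ _ _ _ (Hr F)).
have -> : G u - (F + c *: D F + (e *: D (D F) + (c ^+ 2 / 2) *: H F F)) =
    (G u - G 0 - D u - 2^-1 *: H u u) + D w + 2^-1 *: (H v u + c *: H F v).
  rewrite Dw Hv HFv; apply/rowP => i; rewrite !mxE -/F; by field.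
apply: (@le_trans _ _ ((M * eps) * (C1 * eps) ^+ 3 + (M * eps) * (C * eps ^+ 3)
   + ((M * eps) * ((C2 * eps ^+ 2) * (C1 * eps)) +
     S * ((M * eps) * ((M * eps) * (C2 * eps ^+ 2))))));
   last by rewrite le_eqVlt; apply/orP; left; apply/eqP; ring.
apply: le_trans (ler_normD _ _) _; apply: lerD.
  apply: le_trans (ler_normD _ _) _; apply: lerD.
    apply: le_trans (jet_taylor3 jG p3 _) _; rewrite ler_wpM2l//.
    by rewrite lerXn2r ?nnegrE//; apply: le_trans uC1.
  by apply: le_trans (jet_D_le jG p2 _) _; rewrite ler_wpM2l.
rewrite normrZ ger0_norm ?invr_ge0//.
apply: le_trans (_ : 1 * `|H v u + c *: H F v| <= _).
  by rewrite ler_wpM2r// invf_le1// ler1n.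
rewrite mul1r; apply: le_trans (ler_normD _ _) _; apply: lerD.
  apply: le_trans (jet_H_le jG p3 _ _) _; rewrite ler_wpM2l//.
  exact: ler_pM.
rewrite normrZ ler_pM//; apply: le_trans (jet_H_le jG p3 _ _) _.
by rewrite ler_wpM2l// ler_pM.
Qed.

(** The bootstrap shared by the exact solution and the scheme. The last
hypothesis says that the displacements u are averages of G(u) with weights that
integrate the constant P to c P and the first degree term c Q to e Q. From
|G(u)| = O(eps) it gives u = O(eps), then alternately one more order for G(u)
by Taylor expansion and one more for u by averaging. The constant K is uniform
in the index set I, which will be a time interval or the set of stages. *)
Lemma picard_expansion p (M S C : R) : (1 <= p <= 3)%N -> 0 <= M -> 0 <= S ->
  exists K : R, forall (eps : R) (I : Type) (u : I -> V) (c e : I -> R) G D H,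
    0 <= eps <= 1 -> jet p (M * eps) G D H ->
    (forall i, `|c i| <= C /\ `|e i| <= C) ->
    (forall (delta : R) P Q, (forall i, `|G (u i) - (P + c i *: Q)| <= delta) ->
       forall i, `|u i - c i *: P - e i *: Q| <= S * delta) ->
    forall i, `|G (u i) - stage_series p (c i) (e i) G D H| <= K * eps ^+ p.+1.
Proof.
move=> /andP[p1 p3] M0 S0.
pose K1 := M * (S * M).
pose K2 := M * ((C * M + S * K1) ^+ 2 + S * K1).
pose C2 := C * M ^+ 2 + S * K2; pose C1 := C * M + C2.
pose K3 := M * (C1 ^+ 3 + S * K2 + C1 * C2 + C * M * C2).
have SK1 : 0 <= S * K1 by rewrite !mulr_ge0.
have SK2 : 0 <= S * K2 by rewrite !mulr_ge0// addr_ge0// sqr_ge0.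
exists (if p == 1%N then K1 else if p == 2%N then K2 else K3).
move=> eps I u c e G D H e01 jG cC picard; have /andP[e0 e1] := e01.
(* Averaging with P = Q = 0 bounds u by the size of G. *)
have u1 i : `|u i| <= S * M * eps.
  have := picard (M * eps) 0 0; rewrite mulrA => /(_ _ i).
  rewrite !scaler0 !subr0; apply=> j; rewrite !scaler0 add0r subr0.
  exact: jet_le jG _.
have g1 i : `|G (u i) - stage_series 1 (c i) (e i) G D H| <= K1 * eps ^+ 2.
  exact: (series_remainder1 _ _ p1 jG M0 e0 (u1 i)).
have [/eqP p_1|pN1] := boolP (p == 1%N); first by rewrite p_1.
have p2 : (2 <= p)%N by rewrite ltn_neqAle eq_sym pN1.
have u2 i : `|u i - c i *: G 0| <= S * K1 * eps ^+ 2.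
  have := picard (K1 * eps ^+ 2) (G 0) 0; rewrite mulrA => /(_ _ i).
  rewrite !scaler0 !subr0; apply=> j; rewrite scaler0 addr0.
  by have := g1 j; rewrite /stage_series /= !addr0.
have g2 i : `|G (u i) - stage_series 2 (c i) (e i) G D H| <= K2 * eps ^+ 3.
  exact: (series_remainder2 _ p2 jG M0 SK1 e01 (cC i).1 (u2 i)).
have [/eqP p_2|pN2] := boolP (p == 2%N); first by rewrite p_2.
have p_3 : p = 3%N by apply/eqP; rewrite eqn_leq p3 ltn_neqAle eq_sym pN2.
have u3 i : `|u i - c i *: G 0 - e i *: D (G 0)| <= S * K2 * eps ^+ 3.
  rewrite -mulrA; apply: picard => j.
  by have := g2 j; rewrite /stage_series /= !addr0.
rewrite p_3 in jG * => i.
exact: (series_remainder3 (leqnn 3) erefl erefl jG M0 SK2 e01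
  (cC i).1 (cC i).2 (u3 i)).
Qed.

End Expansion.

(** * Expansion of the local error *)

Section ExactSolution.
Context {R : realType} {m : nat}.
Local Notation V := 'rV[R]_m.

Lemma is_derive_affine_pow (a h t : R) (k : nat) :
  is_derive t 1 (fun u => ((u - a) / h) ^+ k.+1 / (k.+1)`!%:R)
    (h^-1 * (((t - a) / h) ^+ k / (k`!)%:R)).
Proof.
rewrite mulrC; apply: is_derive_pow_fact.
rewrite (_ : (fun _ => _) = h^-1 \*: ((id : R -> R) - cst a)).
  by apply: is_derive_eq; rewrite subr0 [_ *: _]mulr1.
by apply/funext => u; rewrite mulrC.
Qed.

(** The integrated form of the equation: an approximation of the right-hand side
by a quadratic polynomial in the rescaled time is inherited by the primitives. *)
Lemma ode_expansion (G : V -> V) (u : R -> V) (t0 h delta : R) (P Q W : V) :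
  0 < h -> u t0 = 0 -> {within `[t0, t0 + h], continuous u} ->
  (forall t, t0 < t < t0 + h -> is_derive t 1 u (h^-1 *: G (u t))) ->
  (forall t, t0 <= t <= t0 + h ->
    `|G (u t) - (P + ((t - t0) / h) *: Q + (((t - t0) / h) ^+ 2 / 2) *: W)|
      <= delta) ->
  forall t, t0 <= t <= t0 + h ->
    `|u t - ((t - t0) / h) *: P - (((t - t0) / h) ^+ 2 / 2) *: Q
      - (((t - t0) / h) ^+ 3 / 6) *: W| <= delta.
Proof.
move=> h0 u0 cu du GP t tI.
pose a (k : nat) (t : R) := ((t - t0) / h) ^+ k.+1 / (k.+1)`!%:R.
pose v t : V := u t - a 0 t *: P - a 1 t *: Q - a 2 t *: W.
pose dv t : V := h^-1 *: (G (u t) - (P + ((t - t0) / h) *: Q +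
   (((t - t0) / h) ^+ 2 / 2) *: W)).
have da k (z : R) (B : V) := is_derive_scalel B (is_derive_affine_pow t0 h z k).
have dvP z : t0 < z < t0 + h -> is_derive z 1 v (dv z).
  move=> zI; have := is_deriveB (is_deriveB (is_deriveB (du z zI)
    (da 0%N z P)) (da 1%N z Q)) (da 2%N z W) => dz.
  apply: (is_derive_eq dz); rewrite !fact0 /dv !scalerBr !scalerDr !opprD !addrA.
  by rewrite expr0 expr1 divr1 mulr1 !scalerA divr1.
have cv : {within `[t0, t0 + h], continuous v}.
  have ca k (B : V) : {within `[t0, t0 + h], continuous (fun t : R => a k t *: B)}.
    by apply: continuous_subspaceT; exact: derive_continuous (fun z => da k z B).
  move=> z; apply: continuousB (ca 2%N W z).
  by apply: continuousB (ca 1%N Q z); apply: continuousB (ca 0%N P z); exact: cu.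
have dv_le z : t0 < z < t0 + h -> `|dv z| <= h^-1 * delta.
  move=> /andP[z0 z1]; rewrite normrZ gtr0_norm ?invr_gt0//.
  by rewrite ler_pM2l ?invr_gt0// GP// !ltW.
have := mean_value_le dvP cv dv_le tI.
have -> : v t0 = 0.
  by rewrite /v /a u0 !subrr !mul0r !expr0n /= !mul0r !scale0r !subr0.
have -> : v t = u t - ((t - t0) / h) *: P - (((t - t0) / h) ^+ 2 / 2) *: Q
      - (((t - t0) / h) ^+ 3 / 6) *: W by rewrite /v /a /= expr1 divr1.
rewrite subr0 => /le_trans; apply.
have delta0 : 0 <= delta by apply: le_trans (GP t tI).
rewrite mulrAC ler_piMl// mulrC ler_pdivrMr// mul1r.
by case/andP: tI => _; rewrite addrC lerBlDr.
Qed.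

End ExactSolution.

Lemma derive1_linear_piece {R : realType} {d : nat} (X : R -> 'rV[R]_d)
    (a h t : R) :
  derive1 (linear_piece X a (a + h)) t = h^-1 *: (X (a + h) - X a).
Proof.
set x := X (a + h) - X a.
have := is_deriveD (is_derive_cst (X a) t 1)
  (is_derive_scalel x (is_derive_affine_pow a h t 0)).
rewrite expr0 fact0 divr1 mulr1 add0r => dz.
rewrite derive1E -(@derive_val _ _ _ _ _ _ _ dz); congr ('D_1 _ t).
by apply/funext => r; rewrite /linear_piece [in LHS]addrAC subrr add0r
  addrfctE divr1.
Qed.

Section LocalError.
Context {R : realType} {d m s : nat}.
Local Notation V := 'rV[R]_m.
Implicit Types (f : 'I_d -> V -> V) (A : 'M[R]_s) (b : 'rV[R]_s).

(** The difference of the exact and numerical increments up to degree p: each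
coefficient is a multiple of the residual of one order condition. *)
Definition defect (p : nat) A b (F DF DDF HFF : V) : V :=
  (1 - \sum_i b 0 i) *: F +
  (if (2 <= p)%N then (2^-1 - \sum_i b 0 i * rk_c A i) *: DF else 0) +
  (if (3 <= p)%N then
    (6^-1 - \sum_i \sum_j b 0 i * A i j * rk_c A j) *: DDF +
    (6^-1 - (\sum_i b 0 i * rk_c A i ^+ 2) / 2) *: HFF else 0).

(** For stages the averaging operator is the matrix A, which maps constants P to
c_i P and the values c_j Q to (sum_j a_ij c_j) Q. *)
Lemma rk_stage_expansion p A (M : R) : (1 <= p <= 3)%N -> 0 <= M ->
  exists K : R, forall (eps : R) (u : 'I_s -> V) G D H,
    0 <= eps <= 1 -> jet p (M * eps) G D H ->
    (forall i, u i = \sum_j A i j *: G (u j)) ->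
    forall i, `|G (u i) -
      stage_series p (rk_c A i) (\sum_j A i j * rk_c A j) G D H|
      <= K * eps ^+ p.+1.
Proof.
move=> p13 M0.
pose S := \sum_i \sum_j `|A i j|.
pose C := \sum_i (`|rk_c A i| + `|\sum_j A i j * rk_c A j|).
have S0 : 0 <= S by apply: sumr_ge0 => i _; exact: sumr_ge0.
have rowS i : \sum_j `|A i j| <= S.
  by rewrite [leRHS](bigD1 i)//= lerDl sumr_ge0// => k _; exact: sumr_ge0.
have C_i i : `|rk_c A i| + `|\sum_j A i j * rk_c A j| <= C.
  by rewrite [leRHS](bigD1 i)//= lerDl sumr_ge0// => k _; exact: addr_ge0.
have [K KP] := @picard_expansion R m p M S C p13 M0 S0.
exists K => eps u G D H e01 jG uE.
apply: KP => // [i|delta P Q GP i].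
  by split; apply: le_trans (C_i i); rewrite ?lerDl ?lerDr.
rewrite uE /rk_c !scaler_suml -!sumrB.
under eq_bigr do rewrite -scalerA -!scalerBr -addrA -opprD.
apply: le_trans (norm_lincomb _ GP) _; rewrite ler_wpM2r//.
by apply: le_trans (GP i).
Qed.

(** Pure bookkeeping: the increments are w and B, and each parenthesis on the
right is what one of the two expansions bounds. *)
Lemma series_gap p (s1 s2 s3 s4 : R) (w B F DF DDF HFF : V) :
  w - B - ((1 - s1) *: F + (if (2 <= p)%N then (2^-1 - s2) *: DF else 0) +
    (if (3 <= p)%N then (6^-1 - s3) *: DDF + (6^-1 - s4) *: HFF else 0)) =
  w - F - 2^-1 *: (if (2 <= p)%N then DF else 0)
    - 6^-1 *: (if (3 <= p)%N then DDF + HFF else 0) -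
  (B - (s1 *: F + s2 *: (if (2 <= p)%N then DF else 0) +
     (if (3 <= p)%N then s3 *: DDF + s4 *: HFF else 0))).
Proof.
by case: (2 <= p)%N; case: (3 <= p)%N; rewrite ?scaler0 ?addr0 ?subr0;
  apply/rowP => i; rewrite !mxE; ring.
Qed.

(** The heart of both directions. The size of the increment enters only through
|x| <= C eps, so that eps can be chosen as h^alpha for a general driver and as
h^beta for the test driver; K does not depend on h or on the driver. *)
Lemma local_error_expansion p A b f (C : R) (y0 : V) :
  (1 <= p <= 3)%N -> (forall k, smooth_bounded (f k) p) ->
  exists K : R, forall (eps : R) (X : R -> 'rV[R]_d) t0 h y Y,
    0 <= eps <= 1 -> 0 < h ->
    let x := X (t0 + h) - X t0 in
    let D u := field_derive f y0 x [:: u] in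
    let H u v := field_derive f y0 x [:: u; v] in
    let F := field_app f y0 x in
    `|x| <= C * eps ->
    solves_pl_ode f X t0 h y0 y -> rk_stages A f y0 x Y ->
    `|local_error b f X t0 h y0 y Y - defect p A b F (D F) (D (D F)) (H F F)|
      <= K * eps ^+ p.+1.
Proof.
move=> p13 sf; have [M0 M00 jM] := field_jet sf.
(* M0 |x| <= M eps, the small factor of the jet. *)
pose M := M0 * `|C|; have Mge0 : 0 <= M by rewrite mulr_ge0.
have [K1 K1P] := rk_stage_expansion A p13 Mge0.
have [K2 K2P] := @picard_expansion R m p M 1 1 p13 Mge0 ler01.
exists (K2 + (\sum_i `|b 0 i|) * K1).
move=> eps X t0 h y Y e01 h0 x D H F xC [y0E cy dy] YE.
have /andP[e0 e1] := e01.
pose G u := field_app f (y0 + u) x.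
have G0 : G 0 = F by rewrite /G addr0.
have jG : jet p (M * eps) G D H.
  apply: jet_widen (jM x y0); rewrite -mulrA ler_wpM2l//; apply: le_trans xC _.
  by rewrite ler_wpM2r// ler_norm.
pose u i := Y i - y0.
have uE i : u i = \sum_j A i j *: G (u j).
  rewrite /u {1}(YE i) addrC addKr; apply: eq_bigr => j _.
  by rewrite /G addrC subrK.
have rk_le := norm_lincomb (fun i => b 0 i) (K1P _ _ _ _ _ e01 jG uE).
pose w t := y t - y0.
have w0 : w t0 = 0 by rewrite /w y0E subrr.
have cw : {within `[t0, t0 + h], continuous w}.
  by move=> z; apply: continuousB; [exact: cy|exact: cst_continuous].
have dlin z : derive1 (linear_piece X t0 (t0 + h)) z = h^-1 *: x.
  exact: derive1_linear_piece.
have dw t : t0 < t < t0 + h -> is_derive t 1 w (h^-1 *: G (w t)).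
  move=> /dy; rewrite dlin => dyt.
  have := is_deriveB dyt (is_derive_cst y0 t 1) => dz; apply: (is_derive_eq dz).
  rewrite subr0 /G /w addrC subrK scaler_sumr; apply: eq_bigr => k _.
  by rewrite mxE scalerA.
(* The bootstrap is indexed by the times of the step; at rescaled time c a
   trajectory has second coefficient c^2 / 2. *)
pose c (i : {t : R | t0 <= t <= t0 + h}) := (sval i - t0) / h.
have c01 i : 0 <= c i <= 1.
  rewrite /c; case: i => t /= /andP[t1 t2].
  by rewrite divr_ge0 ?subr_ge0 ?(ltW h0)//= ler_pdivrMr// mul1r lerBlDl.
have sol_le := K2P eps {t : R | t0 <= t <= t0 + h} (fun i => w (sval i)) c
  (fun i => c i ^+ 2 / 2) G D H e01 jG.
have {sol_le} w_le : forall i, `|G (w (sval i)) -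
    stage_series p (c i) (c i ^+ 2 / 2) G D H| <= K2 * eps ^+ p.+1.
  apply: sol_le => [i|delta P Q GP [t tI]].
    have /andP[ci0 ci1] := c01 i.
    have e0' : 0 <= c i ^+ 2 / 2 by apply: divr_ge0 => //; exact: exprn_ge0.
    rewrite (ger0_norm ci0) (ger0_norm e0'); split => //.
    rewrite ler_pdivrMr// mul1r; apply: le_trans (_ : 1 <= 2); last by rewrite ler1n.
    exact: exprn_ile1.
  rewrite mul1r; have := @ode_expansion R m G w t0 h delta P Q 0 h0 w0 cw dw _ t tI.
  rewrite !scaler0 subr0; apply => z zI.
  by rewrite scaler0 addr0; exact: (GP (exist _ z zI)).
pose P := G 0.
pose Q := if (2 <= p)%N then D (G 0) else 0.
pose W := if (3 <= p)%N then D (D (G 0)) + H (G 0) (G 0) else 0.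
have ssE c' : stage_series p c' (c' ^+ 2 / 2) G D H =
    P + c' *: Q + (c' ^+ 2 / 2) *: W.
  rewrite /stage_series /P /Q /W; case: (2 <= p)%N; case: (3 <= p)%N;
  by rewrite ?scaler0 ?scalerDr.
(* One more integration, now including the quadratic part, at the end point. *)
have end_le := @ode_expansion R m G w t0 h (K2 * eps ^+ p.+1) P Q W h0 w0 cw dw
  _ (t0 + h) _.
have {end_le} sol_le :
    `|w (t0 + h) - P - 2^-1 *: Q - 6^-1 *: W| <= K2 * eps ^+ p.+1.
  have h1 : (t0 + h - t0) / h = 1 by rewrite addrAC subrr add0r divff// gt_eqF.
  rewrite h1 !expr1n scale1r !div1r in end_le; apply: end_le.
    by move=> z zI; have := w_le (exist _ z zI); rewrite ssE.
  by rewrite lerDl ltW//=.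
rewrite mulrDl -mulrA.
apply: le_trans (lerD sol_le rk_le).
apply: le_trans (ler_normB _ _); rewrite le_eqVlt; apply/orP; left; apply/eqP.
congr `|_|.
have -> : local_error b f X t0 h y0 y Y = w (t0 + h) - \sum_i b 0 i *: G (u i).
  rewrite /local_error /rk_step /w opprD addrA; congr (_ - _).
  by apply: eq_bigr => i _; rewrite /G /u [y0 + _]addrC subrK.
have -> : \sum_i b 0 i *: (G (u i) - stage_series p (rk_c A i)
    (\sum_j A i j * rk_c A j) G D H) = \sum_i b 0 i *: G (u i) -
  ((\sum_i b 0 i) *: P + (\sum_i b 0 i * rk_c A i) *: Q +
   (if (3 <= p)%N then (\sum_i \sum_j b 0 i * A i j * rk_c A j) *: D (D (G 0)) +
     ((\sum_i b 0 i * rk_c A i ^+ 2) / 2) *: H (G 0) (G 0) else 0)).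
  under eq_bigr do rewrite scalerBr; rewrite sumrB; congr (_ - _).
  under eq_bigr do rewrite /stage_series !scalerDr.
  rewrite !big_split -scaler_suml; congr (_ + _ + _).
    rewrite /Q; case: ifP => _; last first.
      by rewrite scaler0; apply: big1 => i _; rewrite scaler0.
    by rewrite scaler_suml; apply: eq_bigr => i _; rewrite scalerA.
  case: ifP => _; last by apply: big1 => i _; rewrite scaler0.
  under eq_bigr do rewrite scalerDr !scalerA.
  rewrite big_split -!scaler_suml; congr (_ *: _ + _ *: _).
    apply: eq_bigr => i _; rewrite mulr_sumr.
    by apply: eq_bigr => j _; rewrite mulrA.
  by rewrite mulr_suml; apply: eq_bigr => i _; rewrite mulrA.
by rewrite /defect /P /Q /W G0 series_gap.
Qed.

End LocalError.

(** * Sufficiency of the order conditions *)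

Section Sufficiency.
Context {R : realType}.

Lemma defect0 (m s p : nat) (A : 'M[R]_s) b (F DF DDF HFF : 'rV[R]_m) :
  (forall l, (1 <= l <= p)%N -> order_condition A b l) -> (1 <= p)%N ->
  defect p A b F DF DDF HFF = 0.
Proof.
move=> oc p1; rewrite /defect (oc 1%N)// subrr scale0r add0r.
case: ifP => p2; case: ifP => p3; rewrite ?addr0//.
- have [-> ->] := oc 3%N p3; rewrite (oc 2%N)// subrr scale0r add0r.
  rewrite subrr scale0r add0r (_ : 6^-1 - _ = 0) ?scale0r//; by field.
- by rewrite (oc 2%N)// subrr scale0r.
- by rewrite (ltnW p3) in p2.
Qed.

Lemma near_at_right0_lt (a : R) : 0 < a -> \forall h \near 0^'+, 0 < h < a.
Proof.
by move=> a0; near=> h; apply/andP; split; near: h;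
  [exact: nbhs_right_gt|exact: nbhs_right_lt].
Unshelve. all: by end_near. Qed.

Lemma powR_natM (h alpha : R) (n : nat) :
  h `^ (n%:R * alpha) = (h `^ alpha) ^+ n.
Proof. by rewrite mulrC powRrM powR_mulrn// powR_ge0. Qed.

(** A Hoelder driver has |x| <= C h^alpha, and the order conditions make the
polynomial part of the local error vanish identically. *)
Lemma order_conditions_sufficient (d m s : nat) (alpha T : R) (p : nat)
    (A : 'M[R]_s) (b : 'rV[R]_s) :
  0 < alpha -> (1 <= p <= 3)%N ->
  (forall l, (1 <= l <= p)%N -> order_condition A b l) ->
  has_local_error_order d m alpha T p A b.
Proof.
move=> alpha0 p13 oc X t0 y0 f yh Yh [[C holX] _] /andP[t00 t0T] sf sol stg.
have [K KP] := local_error_expansion A b C y0 p13 sf.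
have /andP[p1 _] := p13.
apply/eqO_exP; exists (`|K| + 1); first by rewrite ltr_pwDr.
have hsmall : \forall h \near 0^'+, 0 < h < Num.min 1 (T - t0).
  by apply: near_at_right0_lt; rewrite lt_min ltr01 subr_gt0.
near=> h.
have /andP[h0] : 0 < h < Num.min 1 (T - t0) by near: h.
rewrite lt_min => /andP[h1 hT].
have /= := KP (h `^ alpha) X t0 h (yh h) (Yh h).
rewrite defect0// subr0 => le_K.
have {le_K} : `|local_error b f X t0 h y0 (yh h) (Yh h)| <= K * (h `^ alpha) ^+ p.+1.
  apply: le_K => //.
  - rewrite powR_ge0 /=; have := @ge0_ler_powR R alpha (ltW alpha0) h 1.
    by rewrite powR1 !nnegrE ler01 ltW//; apply=> //; exact: ltW.
  - have := holX t0 (t0 + h); rewrite [t0 + h - t0]addrAC subrr add0r.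
    apply => //; first by rewrite lerDl ltW.
    by rewrite -lerBrDl ltW.
  - by near: h.
  - by near: h.
move=> /le_trans; apply.
rewrite powR_natM (ger0_norm (exprn_ge0 _ (powR_ge0 _ _))).
by rewrite ler_wpM2r ?exprn_ge0 ?powR_ge0// (le_trans (ler_norm K))// lerDl.
Unshelve. all: by end_near. Qed.

End Sufficiency.

(** * Piecewise linear interpolation of scalar functions *)

Section PiecewiseLinear.
Context {R : realType}.
Local Notation mu := (@lebesgue_measure R).
Implicit Types (g : R -> R) (a b c s t u : R) (D : seq R) (k : nat).

(** The coordinate version of the interpolation of a path. *)
Fixpoint pl g a D t : R :=
  if D is b :: D' then
    if t <= b then g a + (t - a) / (b - a) * (g b - g a) else pl g b D' t
  else g a.

Lemma pl_interpE d g (e : 'rV[R]_d) a D t :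
  pl_interp (fun t => g t *: e) a D t = pl g a D t *: e.
Proof.
elim: D a => [|b D ih] a //=; case: ifP => // _.
by rewrite /linear_piece -scalerBl scalerA -scalerDl.
Qed.

Lemma pl_left g a D : path <%R a D -> pl g a D a = g a.
Proof.
by case: D => [//|b D] /= /andP[/ltW -> _]; rewrite subrr mul0r mul0r addr0.
Qed.

Lemma pl_tail g a b D t : path <%R a (b :: D) -> b <= t ->
  pl g a (b :: D) t = pl g b D t.
Proof.
move=> /= /andP[ab pD] bt; case: ifP => // tb.
have -> : t = b by apply/eqP; rewrite eq_le tb.
by rewrite divff ?subr_eq0 ?gt_eqF// mul1r addrC subrK pl_left.
Qed.

(** The sum of the absolute slopes is a crude but sufficient constant. *)
Lemma pl_lipschitz g a D : path <%R a D -> exists2 L : R, 0 <= L &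
  forall s t, s <= t -> `|pl g a D t - pl g a D s| <= L * (t - s).
Proof.
elim: D a => [a _|b D ih a pD].
  by exists 0 => // s t _; rewrite subrr normr0 mul0r.
have /andP[ab pD'] : (a < b) && path <%R b D by [].
have [L L0 LP] := ih b pD'.
pose l := `|(g b - g a) / (b - a)|.
have l0 : 0 <= l by exact: normr_ge0.
exists (L + l) => [|s t st]; first exact: addr_ge0.
have tail u : b <= u -> pl g a (b :: D) u = pl g b D u by exact: pl_tail.
have head u v : u <= v -> v <= b ->
    `|pl g a (b :: D) v - pl g a (b :: D) u| <= l * (v - u).
  move=> uv vb; rewrite /= vb (le_trans uv vb).
  rewrite (_ : _ - _ = (g b - g a) / (b - a) * (v - u)); last by ring.
  by rewrite normrM (@ger0_norm _ (v - u)) ?subr_ge0.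
have st0 : 0 <= t - s by rewrite subr_ge0.
rewrite mulrDl; have [tb|/ltW bt] := leP t b.
  by apply: le_trans (head _ _ st tb) _; rewrite lerDr mulr_ge0.
have [bs|/ltW sb] := leP b s.
  rewrite !tail// ; apply: le_trans (LP _ _ st) _.
  by rewrite lerDl mulr_ge0.
rewrite -(subrKA (pl g a (b :: D) b)); apply: le_trans (ler_normD _ _) _.
rewrite lerD//.
  rewrite !tail//; apply: le_trans (LP _ _ bt) _.
  by rewrite ler_wpM2l ?lerB.
by apply: le_trans (head _ _ sb (lexx b)) _; rewrite ler_wpM2l ?lerB.
Qed.

(** Measurability is part of the notion because additivity of the integral over
adjacent intervals requires it. *)
Definition is_primitive (f F : R -> R) s t : Prop :=
  measurable_fun `[s, t] f /\
  (\int[mu]_(x in `[s, t]) (f x)%:E = (F t - F s)%:E)%E.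

Lemma is_primitive_trans (f F : R -> R) s u t : s <= u -> u <= t ->
  is_primitive f F s u -> is_primitive f F u t -> is_primitive f F s t.
Proof.
move=> su ut [msu Isu] [mut Iut].
have stE : [set` `[s, t]] = [set` `[s, u]] `|` [set` `]u, t]] :> set R.
  by rewrite -itv_bndbnd_setU// bnd_simp.
have mut' : measurable_fun `]u, t] f by apply/measurable_fun_itv_obnd_cbndP.
split; first by rewrite stE; apply/measurable_funU.
rewrite stE integral_setU//=.
- rewrite Isu integral_itv_obnd_cbnd ?Iut; last exact/measurable_EFinP.
  by rewrite -EFinD; congr EFin; rewrite addrC subrKA.
- by apply/measurable_EFinP/measurable_funU.
- apply/disj_setPS => y [/=]; rewrite !in_itv/= => /andP[_ yu] /andP[uy _].
  by rewrite ltNge yu in uy.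
Qed.

Lemma is_primitive_point (f F : R -> R) s : is_primitive f F s s.
Proof.
split; first by rewrite set_itv1; exact: measurable_fun_set1.
by rewrite set_itv1 integral_set1 subrr.
Qed.

(** The fundamental theorem of calculus for the powers of g, in the form needed
to compute iterated integrals along a line one after the other. *)
Definition power_primitive g k c s t : Prop :=
  is_primitive (fun u => (g u - c) ^+ k / k`!%:R * derive1 g u)
    (fun u => (g u - c) ^+ k.+1 / k.+1`!%:R) s t.

(** Equality on the closed interval gives equal derivatives only inside it, and
the end points carry no mass. *)
Lemma eq_power_primitive g1 g2 k c s t : s <= t ->
  (forall u, s <= u <= t -> g1 u = g2 u) ->
  power_primitive g1 k c s t -> power_primitive g2 k c s t.
Proof.
rewrite le_eqVlt => /predU1P[<- *|st g12 [m1 I1]]; first exact: is_primitive_point.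
have dg u : u \in `]s, t[ -> derive1 g1 u = derive1 g2 u.
  move=> ust; rewrite !derive1E; apply: near_eq_derive.
  have /near_in_itvoo := ust; apply: filterS => v.
  by rewrite in_itv/= => /andP[sv vt]; rewrite g12// !ltW.
have fE : {in `]s, t[, (fun u => (g1 u - c) ^+ k / k`!%:R * derive1 g1 u) =1
                       (fun u => (g2 u - c) ^+ k / k`!%:R * derive1 g2 u)}.
  move=> u ust; rewrite dg// g12//.
  by move: ust; rewrite in_itv/= => /andP[/ltW -> /ltW ->].
have m1o := measurable_funS (measurable_itv _) (@subset_itv_oo_cc _ _ s t) m1.
have m2o : measurable_fun `]s, t[ (fun u => (g2 u - c) ^+ k / k`!%:R * derive1 g2 u).
  by apply: eq_measurable_fun m1o => u; rewrite inE/= => /fE.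
split.
  by apply/measurable_fun_itv_bndo_bndcP/measurable_fun_itv_obnd_cbndP.
rewrite (eq_integral_itv_bounded _ _ m2o m1o); last by move=> u us; rewrite fE.
by rewrite I1 !g12 ?lexx ?(ltW st).
Qed.

Lemma power_primitive_affine (A B : R) k c s t : s <= t ->
  power_primitive (fun u => A + B * u) k c s t.
Proof.
rewrite le_eqVlt => /predU1P[<-|st]; first exact: is_primitive_point.
pose q u := A + B * u - c.
pose F u := q u ^+ k.+1 / k.+1`!%:R; pose f u := q u ^+ k / k`!%:R * B.
have dgq (u : R) : is_derive u 1 (fun v => A + B * v) B.
  rewrite (_ : (fun _ => _) = cst A + B \*: (id : R -> R)) //.
  by apply: is_derive_eq; rewrite add0r [_ *: _]mulr1.
have dq (u : R) : is_derive u 1 q B.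
  have := is_deriveB (dgq u) (is_derive_cst c u 1).
  by rewrite subr0.
have dF (u : R) : is_derive u 1 F (f u) by exact: is_derive_pow_fact.
have cF : continuous F.
  by move=> u; apply/differentiable_continuous/derivable1_diffP; have := dF u.
have cf : continuous f.
  have -> : f = (k`!%:R^-1 * B) \*: (q ^+ k).
    by apply/funext => v; rewrite /f -mulrA mulrC /= exprfctE.
  by move=> u; apply/differentiable_continuous/derivable1_diffP.
have fE :
    (fun u => (A + B * u - c) ^+ k / k`!%:R * derive1 (fun u => A + B * u) u) = f.
  by apply/funext => u; rewrite derive1E derive_val.
rewrite /power_primitive fE; split.
  apply: measurable_funTS; exact: (continuous_measurable_fun cf).
rewrite EFinB; apply: (@continuous_FTC2 _ f F) => //.
- exact: continuous_subspaceT.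
- split; first by move=> u _; have := dF u.
    exact/cvg_at_right_filter/cF.
  exact/cvg_at_left_filter/cF.
- by move=> u _; rewrite derive1E; have dFu := dF u; rewrite derive_val.
Qed.

(** Cut the interval at the break points: the derivative takes arbitrary values
there, and elsewhere the interpolation is locally affine. *)
Lemma power_primitive_pl g a D k c s t : path <%R a D -> s <= t ->
  power_primitive (pl g a D) k c s t.
Proof.
elim: D a s t => [a s t _ st|b D ih a s t pD st].
  apply: eq_power_primitive (power_primitive_affine (g a) 0 k c st) => // u _.
  by rewrite mul0r addr0.
have /andP[ab pD'] : (a < b) && path <%R b D by [].
have head s' t' : s' <= t' -> t' <= b ->
    power_primitive (pl g a (b :: D)) k c s' t'.
  move=> s't' t'b; pose B := (g b - g a) / (b - a).
  apply: eq_power_primitive (power_primitive_affine (g a - B * a) B k c s't') => //.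
  move=> u /andP[_ ut]; rewrite /= (le_trans ut t'b) /B; ring.
have tail s' t' : s' <= t' -> b <= s' ->
    power_primitive (pl g a (b :: D)) k c s' t'.
  move=> s't' bs'; apply: eq_power_primitive (ih b s' t' pD' s't') => //.
  by move=> u /andP[s'u _]; rewrite (pl_tail _ pD)// (le_trans bs').
have [tb|/ltW bt] := leP t b; first exact: head.
have [bs|/ltW sb] := leP b s; first exact: tail.
exact: is_primitive_trans (head _ _ sb (lexx b)) (tail _ _ bt (lexx b)).
Qed.

Lemma mesh_cons a b D : mesh a (b :: D) = Num.max (b - a) (mesh b D).
Proof. by rewrite /mesh big_ord_recl. Qed.

Lemma mesh_ge0 a D : 0 <= mesh a D.
Proof.
elim: D a => [|b D ih] a; first by rewrite /mesh big_ord0.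
by rewrite mesh_cons le_max ih orbT.
Qed.

Lemma powR_mono (r u v : R) : 0 <= r -> 0 <= u -> u <= v -> u `^ r <= v `^ r.
Proof.
by move=> r0 u0 uv; apply: ge0_ler_powR => //; rewrite nnegrE// (le_trans u0).
Qed.

Section Hoelder.
Variables (g : R -> R) (C beta T : R).
Hypotheses (C0 : 0 <= C) (beta01 : 0 < beta <= 1).
Hypothesis holg : forall s t, 0 <= s -> s <= t -> t <= T ->
  `|g t - g s| <= C * (t - s) `^ beta.

Let beta0 : 0 < beta. Proof. by case/andP: beta01. Qed.

(** On a chord the increments are proportional to the elapsed time, and
r / w <= (r / w)^beta because beta <= 1. *)
Lemma chord_holder (w r : R) (Delta : R) : 0 < w -> 0 <= r <= w ->
  `|Delta| <= C * w `^ beta -> `|r / w * Delta| <= C * r `^ beta.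
Proof.
move=> w0 /andP[r0 rw] DC.
have [->|rN0] := eqVneq r 0.
  by rewrite !mul0r normr0 mulr_ge0// powR_ge0.
have rw01 : 0 < r / w <= 1.
  have r0' : 0 < r by rewrite lt_neqAle eq_sym rN0.
  by rewrite divr_gt0//= ler_pdivrMr// mul1r.
have rw0 : 0 <= r / w by rewrite divr_ge0// ltW.
rewrite normrM (ger0_norm rw0).
apply: le_trans (_ : (r / w) `^ beta * (C * w `^ beta) <= _).
  apply: ler_pM => //; apply: ger1_powR => //; by case/andP: beta01.
rewrite mulrCA -powRM ?(ltW w0)// divfK// gt_eqF//.
Qed.

(** The point u is the last break point before t. *)
Lemma pl_anchor a D t : 0 <= a -> path <%R a D -> last a D <= T ->
  a <= t <= last a D ->
  exists u, [/\ a <= u <= t, t - u <= mesh a D &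
                `|pl g a D t - g u| <= C * (t - u) `^ beta].
Proof.
elim: D a => [|b D ih] a a0 pD lT /= /andP[at_ tl].
  have -> : t = a by apply/eqP; rewrite eq_le at_ tl.
  exists a; rewrite lexx !subrr normr0 mesh_ge0; split=> //.
  by rewrite mulr_ge0// powR_ge0.
have /andP[ab pD'] : (a < b) && path <%R b D by [].
have bT : b <= T.
  apply: le_trans lT => /=; have : itv_partition b (last b D) D by split.
  exact: itv_partition_le.
case: ifP => [tb|/negbT]; last first.
  rewrite -ltNge => /ltW bt.
  have [|u [/andP[bu ut] um uC]] := ih b (le_trans a0 (ltW ab)) pD' lT.
    by rewrite bt.
  exists u; rewrite ut (le_trans (ltW ab) bu) mesh_cons le_max um orbT.
  by split.
exists a; rewrite lexx at_ mesh_cons le_max lerB//; split=> //.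
rewrite addrAC subrr add0r; apply: chord_holder; rewrite ?subr_gt0//.
  by rewrite subr_ge0 at_ lerB.
by apply: holg => //; exact: ltW.
Qed.

(** Between different pieces pass through the first break point after s and the
last one before t; each of the three increments obeys the exponent beta. *)
Lemma pl_holder a D s t : 0 <= a -> path <%R a D -> last a D <= T ->
  a <= s -> s <= t -> t <= last a D ->
  `|pl g a D t - pl g a D s| <= 3 * C * (t - s) `^ beta.
Proof.
elim: D a s t => [|b D ih] a s t a0 pD lT as_ st tl.
  by rewrite subrr normr0 !mulr_ge0// powR_ge0.
have /andP[ab pD'] : (a < b) && path <%R b D by [].
have b0 : 0 <= b by exact: le_trans a0 (ltW ab).
have bT : b <= T.
  apply: le_trans lT => /=; have : itv_partition b (last b D) D by split.
  exact: itv_partition_le.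
have head u v : a <= u -> u <= v -> v <= b ->
    `|pl g a (b :: D) v - pl g a (b :: D) u| <= C * (v - u) `^ beta.
  move=> au uv vb; rewrite /= vb (le_trans uv vb).
  rewrite (_ : _ - _ = (v - u) / (b - a) * (g b - g a)); last by ring.
  apply: chord_holder; rewrite ?subr_gt0//; last exact/holg/bT/ltW.
  by rewrite subr_ge0 uv lerB.
have C3 : C <= 3 * C by rewrite ler_peMl// ler1n.
have [tb|/ltW bt] := leP t b.
  by apply: le_trans (head _ _ as_ st tb) _; rewrite ler_wpM2r// powR_ge0.
have [bs|/ltW sb] := leP b s.
  by rewrite !(pl_tail _ pD)//; exact: ih.
have [|u [/andP[bu ut] _ uC]] := pl_anchor b0 pD' lT (t := t).
  by rewrite bt.
rewrite (_ : _ - _ = (pl g b D t - g u) + (g u - g b) +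
   (pl g a (b :: D) b - pl g a (b :: D) s)); last first.
  by rewrite (pl_tail _ pD bt) (pl_tail _ pD (lexx b)) (pl_left _ pD'); ring.
rewrite (_ : 3 * C * _ = C * (t - s) `^ beta + C * (t - s) `^ beta
   + C * (t - s) `^ beta); last by ring.
have le_ts r : 0 <= r -> r <= t - s -> C * r `^ beta <= C * (t - s) `^ beta.
  by move=> r0 rts; rewrite ler_wpM2l// powR_mono// ltW.
apply: le_trans (ler_normD _ _) _; apply: lerD.
  apply: le_trans (ler_normD _ _) _; apply: lerD.
    apply: le_trans uC _.
    by apply: le_ts; [rewrite subr_ge0|rewrite lerB// (le_trans sb)].
  apply: le_trans (holg b0 bu (le_trans ut (le_trans tl lT))) _.
  by apply: le_ts; [rewrite subr_ge0|rewrite lerB].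
apply: le_trans (head _ _ as_ sb (lexx b)) _.
by apply: le_ts; [rewrite subr_ge0|rewrite lerB].
Qed.

Lemma pl_approx a D t : 0 <= a -> path <%R a D -> last a D <= T ->
  a <= t <= last a D -> `|pl g a D t - g t| <= 2 * C * mesh a D `^ beta.
Proof.
move=> a0 pD lT atl; have [u [/andP[au ut] um uC]] := pl_anchor a0 pD lT atl.
have /andP[at_ tl] := atl.
rewrite -(subrKA (g u)); apply: le_trans (ler_normD _ _) _.
rewrite (distrC (g u)).
rewrite (_ : 2 * C * _ = C * mesh a D `^ beta + C * mesh a D `^ beta);
  last by ring.
(* Both pl g t and g t are compared with the value at the break point u. *)
have mono : C * (t - u) `^ beta <= C * mesh a D `^ beta.
  by rewrite ler_wpM2l// powR_mono ?subr_ge0// ltW.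
apply: lerD; first exact: le_trans uC mono.
apply: le_trans mono; apply: holg => //; first exact: le_trans a0 au.
exact: le_trans tl lT.
Qed.

(** Interpolation between two estimates of exponent beta: for times closer than
the mesh both paths have small increments, and for times further apart the
paths are uniformly close. Either way a power beta - alpha of the mesh is
gained, which is why the exponent has to be lowered. *)
Lemma pl_holder_approx alpha a D s t : 0 < alpha -> alpha < beta ->
  0 <= a -> path <%R a D -> last a D <= T ->
  a <= s -> s <= t -> t <= last a D ->
  `|(pl g a D t - pl g a D s) - (g t - g s)| <=
    4 * C * mesh a D `^ (beta - alpha) * (t - s) `^ alpha.
Proof.
move=> alpha0 ab a0 pD lT as_ st tl.
have ts0 : 0 <= t - s by rewrite subr_ge0.
have ba0 : 0 <= beta - alpha by rewrite subr_ge0 ltW.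
have split_beta r : r `^ beta = r `^ (beta - alpha) * r `^ alpha.
  by rewrite -powRD subrK// gt_eqF.
(* For t - s <= mesh, (t - s)^beta <= mesh^(beta - alpha) (t - s)^alpha;
   otherwise mesh^beta <= mesh^(beta - alpha) (t - s)^alpha. *)
have [small|/ltW large] := leP (t - s) (mesh a D).
  apply: le_trans (ler_normB _ _) _.
  apply: (@le_trans _ _ (3 * C * (t - s) `^ beta + C * (t - s) `^ beta)).
    apply: lerD; first exact: pl_holder.
    by apply: holg => //; [exact: le_trans a0 as_|exact: le_trans tl lT].
  rewrite -mulrDl (_ : 3 * C + C = 4 * C); last by ring.
  rewrite split_beta -[leRHS]mulrA ler_wpM2l ?mulr_ge0// ler_wpM2r ?powR_ge0//.
  exact: powR_mono.
rewrite (_ : _ - _ = (pl g a D t - g t) - (pl g a D s - g s)); last by ring.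
apply: le_trans (ler_normB _ _) _.
apply: (@le_trans _ _ (2 * C * mesh a D `^ beta + 2 * C * mesh a D `^ beta)).
  apply: lerD; apply: pl_approx => //; first by rewrite (le_trans as_ st).
  by rewrite as_ (le_trans st).
rewrite -mulrDl (_ : 2 * C + 2 * C = 4 * C); last by ring.
rewrite split_beta -[leRHS]mulrA ler_wpM2l ?mulr_ge0// ler_wpM2l ?powR_ge0//.
by apply: powR_mono; rewrite ?mesh_ge0// ltW.
Qed.

End Hoelder.

Lemma pl_id g a D t : (forall u, a <= u -> g u = u) -> path <%R a D ->
  a <= t <= last a D -> pl g a D t = t.
Proof.
elim: D a => [|b D ih] a gid pD /= /andP[at_ tl].
  by rewrite gid//; apply/eqP; rewrite eq_le at_ tl.
have /andP[ab pD'] : (a < b) && path <%R b D by [].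
case: ifP => [tb|/negbT]; last first.
  rewrite -ltNge => /ltW bt; rewrite ih ?bt// => u bu.
  by rewrite gid// (le_trans (ltW ab)).
by rewrite !gid ?(ltW ab)// divfK ?subr_eq0 ?gt_eqF// addrC subrK.
Qed.

Lemma exists_fine_partition T (delta : R) : 0 < T -> 0 < delta ->
  exists2 D, itv_partition 0 T D & mesh 0 D < delta.
Proof.
move=> T0 d0; pose n := Num.truncn (T / delta).
have nP : T / delta < n.+1%:R by exact: truncnS_gt.
have Tn : T / n.+1%:R < delta.
  by rewrite ltr_pdivrMr ?ltr0n// mulrC -ltr_pdivrMr.
(* The equidistant partition. *)
pose x i := T * i%:R / n.+1%:R.
pose D := [seq x i | i <- iota 1 n.+1].
have nthD i : (i <= n.+1)%N -> nth 0 (0 :: D) i = x i.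
  case: i => [|i] ile; first by rewrite /x mulr0 mul0r.
  by rewrite /= (nth_map 0%N) ?size_iota// nth_iota.
have sD : size D = n.+1 by rewrite size_map size_iota.
have xS i : x i.+1 - x i = T / n.+1%:R.
  by rewrite /x -mulrBl -mulrBr -natrB// subSnn mulr1.
exists D.
  split; last first.
    rewrite (last_nth 0) sD nthD// /x mulfK ?pnatr_eq0//.
  apply/(pathP 0) => i; rewrite sD => iD.
  rewrite -[nth 0 D i]/(nth 0 (0 :: D) i.+1) !nthD//; last exact: ltnW.
  by rewrite -subr_gt0 xS divr_gt0// ltr0n.
apply: le_lt_trans Tn; rewrite /mesh; apply: bigmax_le => [|i _].
  by rewrite divr_ge0// ltW.
have iD : (i < n.+1)%N by rewrite -sD.
by rewrite !nthD// ?xS// ltnW.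
Qed.

End PiecewiseLinear.

(** * Rough drivers on a line *)

Section LineLifts.
Context {R : realType} {d : nat}.
Implicit Types (g : R -> R) (k : 'I_d) (s t u C eta : R) (w : seq 'I_d).

Definition line_path g k : R -> 'rV[R]_d := fun t => g t *: delta_mx 0 k.

(** A path along a coordinate axis has iterated integrals only in the words that
repeat that axis. *)
Definition line_lift g k : tensor_functional := fun s t w =>
  if all (pred1 k) w then (g t - g s) ^+ size w / (size w)`!%:R else 0.

Lemma norm_delta_mx_le1 k : `|delta_mx 0 k : 'rV[R]_d| <= 1.
Proof.
by apply: rV_norm_le => // i; rewrite mxE eqxx /=; case: eqP; rewrite ?normr1 ?normr0.
Qed.

Lemma natural_lift_line g k s t w : s <= t ->
  (forall n c a b, a <= b -> power_primitive g n c a b) ->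
  natural_lift (line_path g k) s t w = line_lift g k s t w.
Proof.
move=> st gP; rewrite /natural_lift /line_lift -all_rev -(size_rev w).
elim: (rev w) t st => [|i r ih] t st /=; first by rewrite expr0 fact0 divr1.
have compE : (fun v => line_path g k v 0 i) = (fun v => g v * (i == k)%:R).
  by apply/funext => v; rewrite !mxE eqxx.
transitivity (Rintegral (@lebesgue_measure R) `[s, t] (fun u =>
    (if all (pred1 k) r then (g u - g s) ^+ size r / (size r)`!%:R else 0) *
    derive1 (fun v => g v * (i == k)%:R) u)).
  apply: eq_Rintegral => u; rewrite inE/= in_itv/= => /andP[su _].
  by rewrite ih// compE.
have [ik|ik] /= := eqVneq i k; last first.
  have -> : (fun v => g v * 0) = cst 0 by apply/funext => v; rewrite mulr0.
  under eq_Rintegral do rewrite derive1_cst mulr0.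
  by rewrite /Rintegral integral0.
case: ifP => _; last first.
  by under eq_Rintegral do rewrite mul0r; rewrite /Rintegral integral0.
have -> : (fun v => g v * 1) = g by apply/funext => v; rewrite mulr1.
have [_] := gP (size r) (g s) s t st.
by rewrite /Rintegral => ->; rewrite subrr expr0n mul0r subr0.
Qed.

(** On the words that do not vanish this is the binomial theorem. *)
Lemma line_lift_multiplicative alpha T g k :
  multiplicative_functional alpha T (line_lift g k).
Proof.
split=> [s t _ _ _|s u t w _ _ _ _ _]; first by rewrite /line_lift /= fact0 divr1.
rewrite /line_lift; case: ifPn => [kw|].
  transitivity (\sum_(i < (size w).+1) (g u - g s) ^+ i / i`!%:R *
      ((g t - g u) ^+ (size w - i) / (size w - i)`!%:R)).
    rewrite -(subrKA (g u)) exprDn mulr_suml; apply: eq_bigr => i _.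
    have ile : (i <= size w)%N by rewrite -ltnS.
    have := congr1 (fun n => n%:R : R) (bin_fact ile); rewrite /= !natrM => binE.
    have f0 n : n`!%:R != 0 :> R by rewrite pnatr_eq0 -lt0n fact_gt0.
    rewrite -mulr_natr -binE; move: (f0 i) (f0 (size w - i)%N).
    have b0 : 'C(size w, i)%:R != 0 :> R by rewrite pnatr_eq0 -lt0n bin_gt0.
    move: b0; set b := ('C(size w, i))%:R; set x := i`!%:R.
    set y := (size w - i)`!%:R => b0 x0 y0.
    by field; rewrite b0 x0 y0.
  apply: eq_bigr => i _; have ile : (i <= size w)%N by rewrite -ltnS.
  move: (kw); rewrite -{1}(cat_take_drop i w) all_cat => /andP[-> ->].
  by rewrite size_drop size_takel.
rewrite -has_predC => nkw; rewrite big1// => i _.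
move: nkw; rewrite -{1}(cat_take_drop i w) has_cat !has_predC => /orP[]/negbTE ->.
  by rewrite mul0r.
by rewrite mulr0.
Qed.

Lemma expr_diff_le (a b r B eta : R) n : 1 <= B -> 0 <= r -> 0 <= eta ->
  `|a| <= B * r -> `|b| <= B * r -> `|a - b| <= eta * r ->
  `|a ^+ n - b ^+ n| <= n%:R * B ^+ n * eta * r ^+ n.
Proof.
move=> B1 r0 eta0 aB bB abe; have B0 : 0 <= B by exact: le_trans B1.
have Br0 : 0 <= B * r by exact: mulr_ge0.
elim: n => [|n ih]; first by rewrite subrr normr0 !mul0r.
(* Telescoping: change one factor at a time. *)
rewrite (_ : _ - _ = a * (a ^+ n - b ^+ n) + (a - b) * b ^+ n); last first.
  by rewrite !exprS; ring.
apply: (@le_trans _ _ (B * r * (n%:R * B ^+ n * eta * r ^+ n) +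
  eta * r * (B ^+ n.+1 * r ^+ n))).
  apply: le_trans (ler_normD _ _) _; rewrite !normrM normrX.
  apply: lerD; apply: ler_pM => //.
  apply: (@le_trans _ _ ((B * r) ^+ n)); first by rewrite lerXn2r ?nnegrE.
  rewrite exprMn ler_wpM2r ?exprn_ge0// exprS ler_peMl// exprn_ge0//.
by rewrite le_eqVlt; apply/orP; left; apply/eqP; rewrite -natr1 !exprS; ring.
Qed.

Lemma rp_dist_line_le alpha T g1 g2 k C eta : 0 < eta <= 1 -> 0 <= C ->
  (forall s t, 0 <= s -> s <= t -> t <= T -> `|g2 t - g2 s| <= C * (t - s) `^ alpha) ->
  (forall s t, 0 <= s -> s <= t -> t <= T ->
    `|(g1 t - g1 s) - (g2 t - g2 s)| <= eta * (t - s) `^ alpha) ->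
  (rp_dist alpha T (line_lift g1 k) (line_lift g2 k) <=
    ((rp_level alpha)%:R * (C + 1) ^+ rp_level alpha * eta)%:E)%E.
Proof.
move=> /andP[eta0 eta1] C0 g2C g12; set N := rp_level alpha.
have C11 : 1 <= C + 1 by rewrite lerDr.
have C10 : 0 <= C + 1 by rewrite addr_ge0.
apply: ge_ereal_sup => _ [s [t [w [s0 st tT /andP[_ wN] ->]]]].
rewrite lee_fin.
have ts0 : 0 < t - s by rewrite subr_gt0.
rewrite powR_natM ler_pdivrMr ?exprn_gt0 ?powR_gt0//.
set r := (t - s) `^ alpha; have r0 : 0 <= r by exact: powR_ge0.
have RHS0 : 0 <= N%:R * (C + 1) ^+ N * eta * r ^+ size w.
  by rewrite !mulr_ge0 ?exprn_ge0// ltW.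
rewrite /line_lift; case: ifP => _; last by rewrite subrr normr0.
have fge1 : (1 : R) <= (size w)`!%:R by rewrite ler1n fact_gt0.
rewrite -mulrBl normrM (@ger0_norm _ _^-1) ?invr_ge0//.
rewrite ler_pdivrMr ?(lt_le_trans ltr01)//.
apply: le_trans (_ : N%:R * (C + 1) ^+ N * eta * r ^+ size w <= _); last first.
  by rewrite ler_peMr.
have b2 : `|g2 t - g2 s| <= (C + 1) * r.
  by apply: le_trans (g2C _ _ s0 (ltW st) tT) _; rewrite ler_wpM2r// lerDl.
have b1 : `|g1 t - g1 s| <= (C + 1) * r.
  rewrite -[g1 t - g1 s](subrK (g2 t - g2 s)); apply: le_trans (ler_normD _ _) _.
  rewrite addrC mulrDl lerD//; first exact: g2C (ltW st) tT.
  by apply: le_trans (g12 _ _ s0 (ltW st) tT) _; rewrite ler_wpM2r.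
apply: le_trans (expr_diff_le _ C11 r0 (ltW eta0) b1 b2 (g12 _ _ s0 (ltW st) tT)) _.
rewrite ler_wpM2r ?exprn_ge0// ler_wpM2r ?(ltW eta0)//.
by apply: ler_pM; rewrite ?ler0n ?exprn_ge0 ?ler_nat// ler_weXn2l.
Qed.

(** For paths on a line, Hoelder convergence of the interpolations at the level
of increments controls all iterated integrals, since they are powers of
increments. The interpolations are Lipschitz, so the limit is geometric. *)
Lemma driver_line alpha T g k C : 0 < alpha -> 0 < T -> 0 <= C ->
  (forall s t, 0 <= s -> s <= t -> t <= T -> `|g t - g s| <= C * (t - s) `^ alpha) ->
  (forall eta, 0 < eta -> exists2 delta, 0 < delta &
    forall D, itv_partition 0 T D -> mesh 0 D < delta ->
    forall s t, 0 <= s -> s <= t -> t <= T ->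
    `|(pl g 0 D t - pl g 0 D s) - (g t - g s)| <= eta * (t - s) `^ alpha) ->
  driver alpha T (line_path g k).
Proof.
move=> alpha0 T0 C0 gC gpl.
have limit : limit_of_pl_lifts alpha T (line_path g k) (line_lift g k).
  move=> eps eps0; set N := rp_level alpha.
  pose K := N%:R * (C + 1) ^+ N.
  have K0 : 0 <= K by rewrite mulr_ge0// exprn_ge0// addr_ge0.
  (* eps / 2 because the supremum only inherits non-strict bounds; eta <= 1
     keeps the Hoelder constants of the interpolations below C + 1. *)
  pose eta := Num.min 1 (eps / 2 / (K + 1)).
  have K1 : 0 < K + 1 by rewrite ltr_wpDl.
  have eta0 : 0 < eta by rewrite lt_min ltr01 !divr_gt0.
  have eta1 : eta <= 1 by rewrite ge_min lexx.
  have Keta : K * eta < eps.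
    apply: le_lt_trans (_ : eps / 2 < _); last by lra.
    apply: le_trans (_ : (K + 1) * (eps / 2 / (K + 1)) <= _); last first.
      by rewrite mulrC divfK// gt_eqF.
    by apply: ler_pM; rewrite ?(ltW eta0) ?lerDl// ge_min lexx orbT.
  have [delta delta0 deltaP] := gpl eta eta0.
  exists delta => // D pD mD.
  have liftE s t w : 0 <= s -> s <= t ->
      natural_lift (pl_interp (line_path g k) 0 D) s t w =
      line_lift (pl g 0 D) k s t w.
    move=> s0 st.
    have -> : pl_interp (line_path g k) 0 D = line_path (pl g 0 D) k.
      by apply/funext => u; rewrite pl_interpE.
    apply: natural_lift_line => // n c a b ab; apply: power_primitive_pl => //.
    by case: pD.
  have -> : rp_dist alpha T (natural_lift (pl_interp (line_path g k) 0 D))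
      (line_lift g k) = rp_dist alpha T (line_lift (pl g 0 D) k) (line_lift g k).
    congr ereal_sup; apply/seteqP; split => z [s [t [w [s0 st tT sw ->]]]];
    by exists s, t, w; split=> //; rewrite liftE// ltW.
  apply: le_lt_trans (rp_dist_line_le k _ C0 gC (deltaP D pD mD)) _.
    by rewrite eta0.
  by rewrite lte_fin.
split.
  exists C => s t s0 st tT; rewrite /line_path -scalerBl normrZ.
  rewrite -[leRHS]mulr1; apply: ler_pM => //; first exact: gC.
  exact: norm_delta_mx_le1.
exists (line_lift g k); split=> //.
- split; first split.
  + exact: line_lift_multiplicative.
  + exists ((C + 1) ^+ rp_level alpha) => s t w s0 st tT /andP[_ wN].
    have C11 : 1 <= C + 1 by rewrite lerDr.
    rewrite powR_natM /line_lift; case: ifP => _; last first.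
      by rewrite normr0 mulr_ge0 ?exprn_ge0 ?powR_ge0 ?addr_ge0.
    have fge1 : (1 : R) <= (size w)`!%:R by rewrite ler1n fact_gt0.
    rewrite normrM (@ger0_norm _ _^-1) ?invr_ge0//.
    rewrite ler_pdivrMr ?(lt_le_trans ltr01)// -[leLHS]mulr1.
    apply: ler_pM => //; rewrite normrX.
    apply: (@le_trans _ _ ((C * (t - s) `^ alpha) ^+ size w)).
      by rewrite lerXn2r ?nnegrE ?mulr_ge0 ?powR_ge0//; exact: gC.
    rewrite exprMn ler_wpM2r ?exprn_ge0 ?powR_ge0//.
    apply: le_trans (ler_weXn2l C11 wN).
    by rewrite lerXn2r ?nnegrE ?addr_ge0// lerDl.
  + move=> eps eps0; have [delta delta0 deltaP] := limit eps eps0.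
    have [D pD mD] := exists_fine_partition T0 delta0.
    exists (pl_interp (line_path g k) 0 D); split; last exact: deltaP.
    have [pathD _] := pD; have [L L0 LP] := pl_lipschitz g pathD.
    have lipD u v : u <= v -> `|pl_interp (line_path g k) 0 D v -
        pl_interp (line_path g k) 0 D u| <= L * `|v - u|.
      move=> uv; rewrite !pl_interpE -scalerBl normrZ (@ger0_norm _ (v - u)) ?subr_ge0//.
      rewrite -[leRHS]mulr1; apply: ler_pM => //; first exact: LP.
      exact: norm_delta_mx_le1.
    have PF : ProperFilter (globally (`[0, T]%classic `*` `[0, T]%classic)).
      by apply: (globally_properfilter (a := (0, 0))); rewrite /= !in_itv/= lexx ltW.
    apply: (@klipschitzW _ _ _ L) => -[u v] /= _.
    have [uv|/ltW vu] := leP u v; last exact: lipD.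
    by rewrite distrC [`|u - v|]distrC; exact: lipD.
- move=> s t i s0 st tT; rewrite /line_lift /line_path /= -scalerBl !mxE eqxx /=.
  by case: eqP; rewrite /= ?expr1 ?fact0 ?divr1 ?mulr1 ?mulr0.
Qed.

(** With s = r t the claim is 1 <= r^beta + (1 - r)^beta, and both terms only
increase when the exponent is lowered from 1. *)
Lemma powR_sub_le (beta s t : R) : 0 < beta <= 1 -> 0 <= s -> s <= t ->
  `|t `^ beta - s `^ beta| <= (t - s) `^ beta.
Proof.
move=> /andP[beta0 beta1] s0 st; have t0 : 0 <= t by exact: le_trans st.
rewrite ger0_norm ?subr_ge0; last exact: powR_mono (ltW beta0) s0 st.
have [->|tN0] := eqVneq t 0.
  by rewrite powR0 ?gt_eqF// sub0r (le_trans (y := 0)) ?oppr_le0 ?powR_ge0.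
have tp : 0 < t by rewrite lt_neqAle eq_sym tN0.
have scale r : 0 <= r <= t -> r / t * t `^ beta <= r `^ beta.
  move=> /andP[r0 rt]; have [->|rN0] := eqVneq r 0.
    by rewrite !mul0r powR_ge0.
  have rp : 0 < r by rewrite lt_neqAle eq_sym rN0.
  apply: le_trans (_ : (r / t) `^ beta * t `^ beta <= _).
    rewrite ler_wpM2r ?powR_ge0// ger1_powR// divr_gt0//=.
    by rewrite ler_pdivrMr// mul1r.
  by rewrite -powRM ?divr_ge0// divfK.
rewrite lerBlDr; apply: le_trans (lerD (scale (t - s) _) (scale s _)).
- by rewrite -mulrDl -mulrDl subrK divff// mul1r.
- by rewrite subr_ge0 st gerBl.
- by rewrite s0.
Qed.

(** For beta = alpha = 1 the interpolations of the identity are exact; for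
alpha < beta the mesh is chosen from the gain of [pl_holder_approx]. *)
Lemma driver_powR alpha beta T k : 0 < alpha -> 0 < T -> 0 < beta <= 1 ->
  (alpha < beta \/ alpha = 1 /\ beta = 1) ->
  driver alpha T (line_path (fun t => t `^ beta) k).
Proof.
move=> alpha0 T0 beta01 ab; have /andP[beta0 beta1] := beta01.
have le_ab : 0 <= beta - alpha.
  by rewrite subr_ge0; case: ab => [/ltW//|[-> ->]].
have hol s t : 0 <= s -> s <= t -> t <= T ->
    `|t `^ beta - s `^ beta| <= 1 * (t - s) `^ beta.
  by move=> s0 st _; rewrite mul1r powR_sub_le.
apply: (@driver_line _ _ _ _ (T `^ (beta - alpha))) => //.
- exact: powR_ge0.
- move=> s t s0 st tT; apply: le_trans (powR_sub_le beta01 s0 st) _.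
  rewrite -{1}(subrK alpha beta) powRD ?subrK ?(gt_eqF beta0)//.
  rewrite ler_wpM2r ?powR_ge0//; apply: powR_mono => //; first by rewrite subr_ge0.
  by rewrite lerBlDr (le_trans tT)// lerDl.
- move=> eta eta0; case: ab => [ab|[alpha1 beta_1]]; last first.
    exists 1 => // D [pD /eqP lD] _ s t s0 st tT.
    have gid u : 0 <= u -> u `^ beta = u by rewrite beta_1; exact: powRr1.
    have t0 := le_trans s0 st.
    rewrite !pl_id ?gid// ?lD ?t0 ?s0 ?(le_trans st)// subrr normr0.
    by rewrite mulr_ge0 ?powR_ge0// ltW.
  have ab0 : 0 < beta - alpha by rewrite subr_gt0.
  exists ((eta / 4) `^ (beta - alpha)^-1); first by rewrite powR_gt0// divr_gt0.
  move=> D [pD /eqP lD] mD s t s0 st tT.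
  have lT : last 0 D <= T by rewrite lD.
  have tl : t <= last 0 D by rewrite lD.
  apply: le_trans (pl_holder_approx ler01 beta01 hol alpha0 ab (lexx 0) pD lT s0 st tl) _.
  rewrite ler_wpM2r ?powR_ge0// mulr1 mulrC -ler_pdivlMr//.
  apply: le_trans (powR_mono le_ab (mesh_ge0 _ _) (ltW mD)) _.
  by rewrite -powRrM mulVf ?gt_eqF// powRr1// divr_ge0// ltW.
Qed.

End LineLifts.

(** * Implicit stages and one-dimensional fields *)

(** Combines completeness and norm of row vectors, as the Banach fixed point
theorem requires. *)
HB.instance Definition _ (R : realType) (n : nat) := Complete.on 'rV[R]_n.

Section Stages.
Context {R : realType} {s : nat}.

(** For a small increment z the stage map is a contraction. *)
Lemma stages_exist (A : 'M[R]_s) (phi : R -> R) (L u z : R) : 0 <= L ->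
  (forall a b, `|phi a - phi b| <= L * `|a - b|) ->
  `|z| * ((\sum_i \sum_j `|A i j|) * L) < 1 ->
  exists eta : 'rV[R]_s,
    forall i, eta 0 i = u + z * \sum_j A i j * phi (eta 0 j).
Proof.
move=> L0 phiL; set S := \sum_i _ => small.
pose Phi (v : 'rV[R]_s) : 'rV[R]_s :=
  \row_i (u + z * \sum_j A i j * phi (v 0 j)).
have S0 : 0 <= S by apply: sumr_ge0 => i _; exact: sumr_ge0.
have q0 : 0 <= `|z| * (S * L) by rewrite !mulr_ge0.
have ctr : is_contraction (totalfun Phi).
  exists (NngNum q0); split => //= -[v w] _ /=.
  apply: rV_norm_le => [|i]; first by rewrite mulr_ge0.
  rewrite !mxE opprD addrACA subrr add0r -mulrBr normrM -sumrB.
  rewrite -!mulrA ler_wpM2l//; apply: le_trans (ler_norm_sum _ _ _) _.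
  apply: (@le_trans _ _ ((\sum_j `|A i j|) * (L * `|v - w|))); last first.
    rewrite ler_wpM2r ?mulr_ge0// [leRHS](bigD1 i)//= lerDl sumr_ge0// => k _.
    exact: sumr_ge0.
  rewrite mulr_suml; apply: ler_sum => j _.
  rewrite -mulrBr normrM ler_wpM2l//; apply: le_trans (phiL _ _) _.
  by rewrite ler_wpM2l//; have := rV_coord_le (v - w) j; rewrite !mxE.
have [|eta _ etaP] := banach_fixed_point ctr closedT; first by exists 0.
by exists eta => i; rewrite {1}etaP mxE.
Qed.

End Stages.

Section RidgeField.
Context {R : realType} {m : nat}.
Variables (psi : nat -> R -> R) (i0 : 'I_m).
Hypothesis dpsi : forall n (z : R), is_derive z 1 (psi n) (psi n.+1 z).
Local Notation V := 'rV[R]_m.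
Let e : V := delta_mx 0 i0.

Definition ridge_field (y : V) : V := psi 0 (y 0 i0) *: e.

Lemma differentiable_ridge n (c : R) y :
  differentiable (fun y : V => (c * psi n (y 0 i0)) *: e) y.
Proof.
apply: differentiableZl; apply: differentiableZ.
apply: (@differentiable_comp _ _ _ _ (fun y : V => y 0 i0) (psi n)).
  exact: differentiable_coord.
by apply/derivable1_diffP; have := dpsi n (y 0 i0).
Qed.

(** In the direction v the field moves along a scalar curve with speed v_i0. *)
Lemma derive_ridge n (c : R) v y :
  'D_v (fun y : V => (c * psi n (y 0 i0)) *: e) y =
  (v 0 i0 * c * psi n.+1 (y 0 i0)) *: e.
Proof.
pose curve (t : R) : V := (c * psi n t) *: e.
have dcurve : forall t : R, is_derive t 1 curve ((c * psi n.+1 t) *: e).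
  move=> t.
  exact: (is_derive_scalel e (is_deriveZ c (dpsi n t))).
transitivity ('D_(v 0 i0) curve (y 0 i0)).
  have E : (fun h : R => h^-1 *: ((c * psi n ((h *: v + y) 0 i0)) *: e -
        (c * psi n (y 0 i0)) *: e)) =
      (fun h : R => h^-1 *: (curve (h *: v 0 i0 + y 0 i0) - curve (y 0 i0))).
    by apply/funext => h; rewrite !mxE.
  by rewrite /derive /= E.
have dc : differentiable curve (y 0 i0).
  by apply/derivable1_diffP; have := dcurve (y 0 i0).
rewrite (deriveE _ dc) -[v 0 i0]mulr1 linearZ -(deriveE _ dc).
by rewrite (@derive_val _ _ _ _ _ _ _ (dcurve _)) [LHS]scalerA mulr1 mulrA.
Qed.

Lemma iter_derive_ridge vs : iter_derive ridge_field vs =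
  (fun y => (\prod_(v <- vs) v 0 i0 * psi (size vs) (y 0 i0)) *: e).
Proof.
elim: vs => [|v vs /= ->]; first by apply/funext => y; rewrite big_nil mul1r.
by apply/funext => y; rewrite derive_ridge big_cons.
Qed.

Lemma scalar_lipschitz (B : R) n : (forall z, `|psi n.+1 z| <= B) ->
  forall a b, `|psi n a - psi n b| <= B * `|a - b|.
Proof.
move=> psiB a b; wlog ab : a b / b <= a.
  by move=> H; have [/H//|/ltW/H] := leP b a; rewrite distrC (distrC b).
have cpsi : continuous (psi n).
  by move=> z; apply/differentiable_continuous/derivable1_diffP; have := dpsi n z.
have dpsi' x : x \in `]b, a[%R -> is_derive x 1 (psi n) (psi n.+1 x) by [].
have [c _ ->] := MVT_segment ab dpsi' (continuous_subspaceT cpsi).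
by rewrite normrM ler_wpM2r.
Qed.

Lemma smooth_bounded_ridge (B : nat -> R) p :
  (forall n z, `|psi n z| <= B n) -> smooth_bounded ridge_field p.
Proof.
move=> psiB; have B0 n : 0 <= B n by apply: le_trans (psiB n 0).
have e1 : `|e| <= 1 by exact: norm_delta_mx_le1.
have prod1 vs : (forall v, v \in vs -> `|v : V| <= 1) ->
    `|\prod_(v <- vs) v 0 i0| <= 1.
  elim: vs => [|v vs ih] vs1; first by rewrite big_nil normr1.
  rewrite big_cons normrM; apply: mulr_ile1 => //.
    by apply: le_trans (rV_coord_le _ _) (vs1 _ _); rewrite mem_head.
  by apply: ih => w ws; apply: vs1; rewrite inE ws orbT.
split.
- split=> vs _; rewrite iter_derive_ridge; first by move=> y; exact: differentiable_ridge.
  by move=> y; apply: differentiable_continuous; exact: differentiable_ridge.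
- exists (\sum_(n < p.+1) B n) => vs svs vs1 y; rewrite iter_derive_ridge.
  rewrite normrZ normrM -[leRHS]mulr1; apply: ler_pM => //.
  apply: le_trans (_ : 1 * B (size vs) <= _); first exact: ler_pM (prod1 _ vs1) _.
  have svs' : (size vs < p.+1)%N by [].
  rewrite mul1r (bigD1 (Ordinal svs'))//= lerDl sumr_ge0//.
- exists (B p.+1) => vs svs vs1 x y; rewrite iter_derive_ridge svs.
  rewrite -scalerBl -mulrBr normrZ normrM -[leRHS]mulr1; apply: ler_pM => //.
  rewrite -[leRHS]mul1r; apply: ler_pM => //; first exact: prod1.
  apply: le_trans (scalar_lipschitz (psiB p.+1) _ _) _.
  by rewrite ler_wpM2l//; have := rV_coord_le (x - y) i0; rewrite !mxE.
Qed.

End RidgeField.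

(** * Necessity of the order conditions *)

Section TestEquation.
Context {R : realType}.

(** The derivatives of cos^2 z = (1 + cos (2 z)) / 2; each derivation multiplies
by 2 and shifts the phase by pi / 2. *)
Definition cos2_deriv (n : nat) (z : R) : R :=
  (n == 0%N)%:R / 2 + 2 ^+ n / 2 * cos (2 * z + n%:R * (pi / 2)).

Lemma is_derive_cos2 n (z : R) : is_derive z 1 (cos2_deriv n) (cos2_deriv n.+1 z).
Proof.
pose q (z : R) := 2 * z + n%:R * (pi / 2).
have dq : is_derive z 1 q 2.
  rewrite (_ : q = 2 \*: (id : R -> R) + cst (n%:R * (pi / 2))) //.
  by apply: is_derive_eq; rewrite addr0 [_ *: _]mulr1.
have dcq := is_derive1_comp (is_derive_cos (q z)) dq.
have := is_deriveD (is_derive_cst ((n == 0%N)%:R / 2 : R) z 1)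
  (is_deriveZ (2 ^+ n / 2) dcq).
move=> dF; apply: (is_derive_eq dF).
rewrite /cos2_deriv /= mul0r !add0r -[n.+1%:R]natr1 [(n%:R + 1) * _]mulrDl.
rewrite mul1r addrA cosDpihalf.
by rewrite /q /GRing.scale/= exprS; field.
Qed.

Lemma cos2_deriv_le n (z : R) : `|cos2_deriv n z| <= 1 + 2 ^+ n.
Proof.
apply: le_trans (ler_normD _ _) _; apply: lerD.
  rewrite ger0_norm ?divr_ge0// ler_pdivrMr// mul1r.
  by case: (n == 0%N); rewrite ?ler1n ?ler0n.
rewrite normrM -[leRHS]mulr1; apply: ler_pM; rewrite ?cos_max//.
by rewrite ger0_norm ?divr_ge0 ?exprn_ge0// ler_pdivrMr// ler_peMr ?exprn_ge0 ?ler1n.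
Qed.

Lemma cos2_deriv0_atan (q : R) : cos2_deriv 0 (atan q) = (1 + q ^+ 2)^-1.
Proof.
rewrite /cos2_deriv mul0r addr0 expr0 [2 * atan q]mulr_natl cos_mulr2n.
have q1 : 0 <= 1 + q ^+ 2 by rewrite addr_ge0// sqr_ge0.
rewrite cos_atan exprVn sqr_sqrtr//=; move: (1 + q ^+ 2)^-1 => w; by field.
Qed.

(** Starting points at which exactly one of the two elementary differentials of
degree 3, psi psi'^2 and psi^2 psi'' with psi = cos^2, is nonzero. *)
Lemma cos2_deriv_atan0 : [/\ cos2_deriv 0 (atan 0) = 1,
  cos2_deriv 1 (atan 0) = 0 & cos2_deriv 2 (atan 0) = - 2].
Proof.
split; first by rewrite cos2_deriv0_atan expr0n addr0 invr1.
  by rewrite atan0 /cos2_deriv mulr0 add0r mul1r cos_pihalf mulr0 mul0r addr0.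
have E : 2 * (pi / 2) = pi :> R by field.
by rewrite atan0 /cos2_deriv mulr0 add0r E cospi /=; field.
Qed.

Lemma cos2_deriv_atan1 : [/\ cos2_deriv 0 (atan 1) = 2^-1,
  cos2_deriv 1 (atan 1) = - 1 & cos2_deriv 2 (atan 1) = 0].
Proof.
have E : 2 * (pi / 4) = pi / 2 :> R by field.
split; first by rewrite cos2_deriv0_atan expr1n.
  rewrite atan1 /cos2_deriv E mul1r (_ : pi / 2 + pi / 2 = pi); last by field.
  by rewrite cospi /= expr1; field.
have E2 : 2 * (pi / 2) = pi :> R by field.
by rewrite atan1 /cos2_deriv E E2 cosDpi cos_pihalf /= mul0r oppr0 mulr0 addr0.
Qed.

End TestEquation.

Section Necessity.
Context {R : realType}.

Lemma powR_bound_eq0 (c K a b : R) : a < b ->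
  (\forall h \near 0^'+, `|c| * h `^ a <= K * h `^ b) -> c = 0.
Proof.
move=> ab H; apply/eqP; rewrite -normr_le0; apply/ler_addgt0Pr => eps eps0.
rewrite add0r.
have ba : 0 < b - a by rewrite subr_gt0.
pose r := (eps / (`|K| + 1)) `^ (b - a)^-1.
have K1 : 0 < `|K| + 1 by rewrite ltr_wpDl.
have r0 : 0 < r by rewrite powR_gt0// divr_gt0.
have near_r := near_at_right0_lt r0.
near (0 : R)^'+ => h.
have /andP[h0 hr] : 0 < h < r by near: h.
have ha : 0 < h `^ a by exact: powR_gt0.
rewrite -(ler_pM2r ha).
apply: le_trans (_ : K * h `^ b <= _); first by near: h.
rewrite -(subrK a b) powRD ?subrK; last by rewrite (gt_eqF h0) implybT.
rewrite mulrA ler_pM2r//.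
apply: le_trans (_ : (`|K| + 1) * h `^ (b - a) <= _).
  by rewrite ler_wpM2r ?powR_ge0// (le_trans (ler_norm K))// lerDl.
rewrite mulrC -ler_pdivlMr//.
apply: le_trans (powR_mono (ltW ba) (ltW h0) (ltW hr)) _.
by rewrite -powRrM mulVf ?gt_eqF// powRr1// divr_ge0// ltW.
Unshelve. all: by end_near. Qed.

Context {d m s : nat} (k0 : 'I_d) (i0 : 'I_m).
Local Notation V := 'rV[R]_m.
Implicit Types (A : 'M[R]_s) (b : 'rV[R]_s) (u z : R).
Let e : V := delta_mx 0 i0.

Definition test_field : 'I_d -> V -> V := fun=> ridge_field cos2_deriv i0.

Definition test_defect l A b u z : R :=
  (1 - \sum_i b 0 i) * (z * cos2_deriv 0 u) +
  (if (2 <= l)%N then (2^-1 - \sum_i b 0 i * rk_c A i) *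
     (z ^+ 2 * (cos2_deriv 0 u * cos2_deriv 1 u)) else 0) +
  (if (3 <= l)%N then
    (6^-1 - \sum_i \sum_j b 0 i * A i j * rk_c A j) *
      (z ^+ 3 * (cos2_deriv 0 u * cos2_deriv 1 u ^+ 2)) +
    (6^-1 - (\sum_i b 0 i * rk_c A i ^+ 2) / 2) *
      (z ^+ 3 * (cos2_deriv 0 u ^+ 2 * cos2_deriv 2 u)) else 0).

Lemma ridge_coord (c : R) : (c *: e) 0 i0 = c.
Proof. by rewrite !mxE !eqxx mulr1. Qed.

Lemma sum_delta (z : R) (w : 'I_d -> V) :
  \sum_k (z *: delta_mx 0 k0 : 'rV[R]_d) 0 k *: w k = z *: w k0.
Proof.
rewrite (bigD1 k0)//= big1 => [|k kk0].
  by rewrite !mxE !eqxx mulr1 addr0.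
by rewrite !mxE eqxx (negbTE kk0) mulr0 scale0r.
Qed.

Lemma field_app_test (y : V) z :
  field_app test_field y (z *: delta_mx 0 k0) = (z * cos2_deriv 0 (y 0 i0)) *: e.
Proof. by rewrite /field_app sum_delta scalerA. Qed.

Lemma field_derive_test (y : V) z vs :
  field_derive test_field y (z *: delta_mx 0 k0) vs =
  (z * (\prod_(v <- vs) v 0 i0 * cos2_deriv (size vs) (y 0 i0))) *: e.
Proof.
by rewrite /field_derive sum_delta (iter_derive_ridge i0 is_derive_cos2) scalerA.
Qed.

Lemma defect_test l A b u z :
  let x := z *: delta_mx 0 k0 in
  let D v := field_derive test_field (u *: e) x [:: v] in
  let H v w := field_derive test_field (u *: e) x [:: v; w] in
  let F := field_app test_field (u *: e) x in
  defect l A b F (D F) (D (D F)) (H F F) = test_defect l A b u z *: e.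
Proof.
move=> x D H F.
have DE v : D v = (z * (v 0 i0 * cos2_deriv 1 u)) *: e.
  by rewrite /D field_derive_test big_seq1 ridge_coord.
have HE v w : H v w = (z * (v 0 i0 * w 0 i0 * cos2_deriv 2 u)) *: e.
  by rewrite /H field_derive_test big_cons big_seq1 ridge_coord.
have FE : F = (z * cos2_deriv 0 u) *: e.
  by rewrite /F field_app_test ridge_coord.
rewrite HE !DE FE !ridge_coord /defect /test_defect.
case: (2 <= l)%N; case: (3 <= l)%N;
  rewrite ?addr0 !scalerA -?scalerDl; congr (_ *: _); ring.
Qed.

(** If y = atan q then y' = q' / (1 + q^2) = q' cos^2 y, so an affine q solves the
test equation. *)
Lemma test_solution u0 z h : 0 < h -> forall X : R -> 'rV[R]_d,
  X (0 + h) - X 0 = z *: delta_mx 0 k0 ->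
  solves_pl_ode test_field X 0 h (atan u0 *: e)
    (fun t => atan (u0 + z / h * t) *: e).
Proof.
move=> h0 X XE; pose q t := u0 + z / h * t.
have dq (t : R) : is_derive t 1 q (z / h).
  rewrite (_ : q = cst u0 + (z / h) \*: (id : R -> R)) //.
  by apply: is_derive_eq; rewrite add0r [_ *: _]mulr1.
have dy (t : R) : is_derive t 1 (fun t => atan (q t) *: e)
    ((z / h * (1 + q t ^+ 2)^-1) *: e).
  have := is_derive_scalel e (is_derive1_comp (is_derive1_atan (q t)) (dq t)).
  by rewrite mulrC.
split; first by rewrite mulr0 addr0.
  by apply: continuous_subspaceT; exact: (derive_continuous dy).
move=> t _; rewrite derive1_linear_piece XE scalerA.
rewrite field_app_test ridge_coord cos2_deriv0_atan.
by rewrite -[h^-1 * z]mulrC; exact: dy.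
Qed.

(** Order p for the test equation implies order l for every l <= p, because the
test field is smooth and h^((p+1) alpha) <= h^((l+1) alpha). The exact
increment of the driver is h^beta, so subtracting the expansion of the local
error leaves its polynomial part. *)
Lemma test_defect_bound alpha beta T p l A b u0 :
  0 < alpha -> 0 < T -> 0 < beta <= 1 ->
  (alpha < beta \/ alpha = 1 /\ beta = 1) -> (1 <= l <= p)%N -> (p <= 3)%N ->
  has_local_error_order d m alpha T p A b ->
  exists K : R, \forall h \near 0^'+,
    `|test_defect l A b (atan u0) (h `^ beta)| <= K * h `^ (l.+1%:R * alpha).
Proof.
move=> alpha0 T0 beta01 ab /andP[l1 lp] p3 order; have /andP[beta0 beta1] := beta01.
have le_ab : alpha <= beta by case: ab => [/ltW//|[-> ->]].
pose X := line_path (fun t : R => t `^ beta) k0.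
have XE h : X (0 + h) - X 0 = h `^ beta *: delta_mx 0 k0.
  by rewrite /X /line_path add0r powR0 ?gt_eqF// scale0r subr0.
pose y0 : V := atan u0 *: e.
pose yh h t : V := atan (u0 + h `^ beta / h * t) *: e.
have phiL := scalar_lipschitz is_derive_cos2 (@cos2_deriv_le R 1%N).
pose L : R := 1 + 2 ^+ 1; have L0 : 0 <= L by rewrite addr_ge0.
pose S := (\sum_i \sum_j `|A i j|) * L.
have S0 : 0 <= S.
  by rewrite mulr_ge0// sumr_ge0// => i _; exact: sumr_ge0.
have /choice[eta etaP] : forall h, exists v : 'rV[R]_s, `|h `^ beta| * S < 1 ->
    forall i, v 0 i = atan u0 + h `^ beta * \sum_j A i j * cos2_deriv 0 (v 0 j).
  move=> h; have [small|large] := pselect (`|h `^ beta| * S < 1).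
    by have [v vP] := stages_exist (atan u0) L0 phiL small; exists v.
  by exists 0.
pose Yh h i : V := eta h 0 i *: e.
have sf k q : smooth_bounded (test_field k) q.
  exact: (smooth_bounded_ridge i0 is_derive_cos2 _ (@cos2_deriv_le R)).
have sol : \forall h \near 0^'+, solves_pl_ode test_field X 0 h y0 (yh h).
  have near01 := near_at_right0_lt (@ltr01 R).
  near=> h; have /andP[h0 _] : 0 < h < 1 by near: h.
  exact: test_solution.
have stg : \forall h \near 0^'+,
    rk_stages A test_field y0 (X (0 + h) - X 0) (Yh h).
  (* Below this step size the increment h^beta is less than 1 / (S + 1), and the
     stage map is a contraction. *)
  have r0 : 0 < (S + 1)^-1 `^ beta^-1 by rewrite powR_gt0// invr_gt0 ltr_wpDl.
  have nearr := near_at_right0_lt r0.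
  near=> h; have /andP[h0 hr] : 0 < h < (S + 1)^-1 `^ beta^-1 by near: h.
  have small : `|h `^ beta| * S < 1.
    rewrite ger0_norm ?powR_ge0//.
    apply: le_lt_trans (_ : (S + 1)^-1 * S < 1).
      rewrite ler_wpM2r//; apply: le_trans (powR_mono (ltW beta0) (ltW h0) (ltW hr)) _.
      by rewrite -powRrM mulVf ?gt_eqF// powRr1// invr_ge0 addr_ge0.
    by rewrite mulrC ltr_pdivrMr ?ltr_wpDl// mul1r ltrDl.
  move=> i; rewrite /Yh {1}(etaP h small i) XE /y0 scalerDl; congr (_ + _).
  rewrite mulr_sumr scaler_suml; apply: eq_bigr => j _.
  by rewrite field_app_test ridge_coord scalerA; congr (_ *: _); ring.
have t0T : 0 <= (0 : R) < T by rewrite lexx.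
have /eqO_exP[c c0 le_c] := order X 0 y0 test_field yh Yh
  (driver_powR k0 alpha0 T0 beta01 ab) t0T (sf^~ p) sol stg.
have l13 : (1 <= l <= 3)%N by rewrite l1 (leq_trans lp).
have [K KP] := local_error_expansion A b 1 y0 l13 (sf^~ l).
exists (`|K| + c).
have near01 := near_at_right0_lt (@ltr01 R).
near=> h.
have /andP[h0 h1] : 0 < h < 1 by near: h.
have hle1 : 0 < h <= 1 by rewrite h0 ltW.
have hb1 : 0 <= h `^ beta <= 1.
  rewrite powR_ge0 /=; have := powR_mono (ltW beta0) (ltW h0) (ltW h1).
  by rewrite powR1.
have := KP (h `^ beta) X 0 h (yh h) (Yh h) hb1 h0 => /=.
rewrite XE defect_test => expansion.
have {expansion} expansion : `|local_error b test_field X 0 h y0 (yh h) (Yh h) -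
    test_defect l A b (atan u0) (h `^ beta) *: e| <= K * (h `^ beta) ^+ l.+1.
  apply: expansion.
  - rewrite normrZ mul1r (ger0_norm (powR_ge0 _ _)) -[leRHS]mulr1 ler_wpM2l ?powR_ge0//.
    exact: norm_delta_mx_le1.
  - by near: h.
  - by have := XE h => <-; near: h.
have le_err : `|local_error b test_field X 0 h y0 (yh h) (Yh h)| <=
    c * h `^ (l.+1%:R * alpha).
  apply: le_trans (_ : c * `|h `^ (p.+1%:R * alpha)| <= _); first by near: h.
  rewrite (ger0_norm (powR_ge0 _ _)) ler_wpM2l ?(ltW c0)//.
  by apply: ger_powR => //; rewrite ler_wpM2r ?(ltW alpha0)// ler_nat ltnS.
set le := local_error _ _ _ _ _ _ _ _ in expansion le_err.
rewrite -[test_defect l A b (atan u0) _]ridge_coord.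
apply: le_trans (rV_coord_le _ _) _.
rewrite -[X in `|X|](subrK le) -normrN opprD opprB.
apply: le_trans (ler_normD _ _) _; rewrite normrN mulrDl; apply: lerD => //.
apply: le_trans expansion _; rewrite -powR_natM.
apply: le_trans (_ : `|K| * h `^ (l.+1%:R * beta) <= _).
  by rewrite ler_wpM2r ?powR_ge0// ler_norm.
by rewrite ler_wpM2l//; apply: ger_powR => //; rewrite ler_wpM2l// ler0n.
Unshelve. all: by end_near. Qed.

(** By induction on the degree l: once the conditions of lower degree hold, the
polynomial part at degree l is a single multiple of h^(l beta), and
l beta < (l + 1) alpha forces the coefficient to vanish. The exponent
beta = min(1, 5 alpha / 4) satisfies this for l <= 3, and exceeds alpha unless
alpha = 1. *)
Lemma order_conditions_necessary alpha T p A b :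
  0 < alpha <= 1 -> 0 < T -> (1 <= p <= 3)%N ->
  has_local_error_order d m alpha T p A b ->
  forall l, (1 <= l <= p)%N -> order_condition A b l.
Proof.
move=> /andP[alpha0 alpha1] T0 /andP[p1 p3] order.
pose beta := Num.min 1 (5 / 4 * alpha).
have a54 : alpha < 5 / 4 * alpha by rewrite ltr_pMl//; lra.
have beta0 : 0 < beta by rewrite lt_min ltr01 (lt_trans alpha0).
have beta01 : 0 < beta <= 1 by rewrite beta0 ge_min lexx.
have ab : alpha < beta \/ alpha = 1 /\ beta = 1.
  have [a1|a1] := ltP alpha 1; first by left; rewrite lt_min a1.
  have aE : alpha = 1 by apply/eqP; rewrite eq_le alpha1.
  by right; split=> //; rewrite /beta aE min_l//; lra.
(* A polynomial part reduced to its term of degree l has coefficient 0. *)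
have coef0 l (c : R) u0 : (1 <= l <= p)%N ->
    (forall z, test_defect l A b (atan u0) z = c * z ^+ l) -> c = 0.
  move=> lp defE.
  have [K KP] := test_defect_bound u0 alpha0 T0 beta01 ab lp p3 order.
  apply: (@powR_bound_eq0 c K (l%:R * beta) (l.+1%:R * alpha)).
    have l3 : (l <= 3)%N by case/andP: lp => _ /leq_trans; exact.
    apply: le_lt_trans (_ : l%:R * (5 / 4 * alpha) < _).
      by rewrite ler_wpM2l// ge_min lexx orbT.
    rewrite mulrA ltr_pM2r// -natr1.
    have : l%:R <= 3 :> R by rewrite ler_nat.
    lra.
  near=> h; rewrite powR_natM.
  rewrite -[X in _ * X](ger0_norm (exprn_ge0 _ (powR_ge0 _ _))) -normrM -defE.
  by near: h.
have [c0_0 c0_1 c0_2] := @cos2_deriv_atan0 R.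
have [c1_0 c1_1 c1_2] := @cos2_deriv_atan1 R.
have oc1 : order_condition A b 1.
  apply/esym/eqP; rewrite -subr_eq0; apply/eqP/(coef0 1%N _ 0) => [|z].
    by rewrite p1.
  by rewrite /test_defect /= c0_0; ring.
have oc2 : (2 <= p)%N -> order_condition A b 2.
  move=> p2; have : - 2^-1 * (2^-1 - \sum_i b 0 i * rk_c A i) = 0.
    apply: (coef0 2%N _ 1) => // z.
    by rewrite /test_defect /= oc1 c1_0 c1_1; ring.
  move/eqP; rewrite mulf_eq0 oppr_eq0 invr_eq0 pnatr_eq0 /= subr_eq0.
  by move=> /eqP.
have oc3 : (3 <= p)%N -> order_condition A b 3.
  move=> p_3; have oc2' := oc2 (ltnW p_3); split.
    have : - 2 * (6^-1 - (\sum_i b 0 i * rk_c A i ^+ 2) / 2) = 0.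
      apply: (coef0 3%N _ 0) => // z.
      by rewrite /test_defect /= oc1 oc2' c0_0 c0_1 c0_2; ring.
    by set q := \sum_i _; lra.
  have : 2^-1 * (6^-1 - \sum_i \sum_j b 0 i * A i j * rk_c A j) = 0.
    apply: (coef0 3%N _ 1) => // z.
    by rewrite /test_defect /= oc1 oc2' c1_0 c1_1 c1_2; ring.
  by set q := \sum_i _; lra.
by case=> [|[|[|[|l]]]].
Unshelve. all: by end_near. Qed.

End Necessity.

Theorem theorem3 (R : realType) (d m s : nat) (alpha T : R) (p : nat)
    (A : 'M[R]_s) (b : 'rV[R]_s)
    (hd : (0 < d)%N) (hm : (0 < m)%N) (hs : (0 < s)%N)
    (halpha : 0 < alpha <= 1) (hT : 0 < T) (hp : (1 <= p <= 3)%N) :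
  has_local_error_order d m alpha T p A b <->
  (forall l : nat, (1 <= l <= p)%N -> order_condition A b l).
Proof.
split; last by apply: order_conditions_sufficient => //; case/andP: halpha.
exact: (order_conditions_necessary (Ordinal hd) (Ordinal hm)).
Qed.
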